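(* Let $c,c'\in\mathbb{R}$ with $|c|<1$, $|c'|<1$ and $c\neq c'$, and let $\pi_c=(c-x_3)\,\pi$ and $\pi_{c'}=(c'-x_3)\,\pi$ be the corresponding necklace Poisson structures on the unit sphere $S^2\subset\mathbb{R}^3$. Then $\pi_c$ and $\pi_{c'}$ are nontrivial deformations of each other: the class of the bivector field $\pi_{c'}-\pi_c=(c'-c)\,\pi$ is nonzero in $H^2_{\pi_c}(S^2)$, and likewise the class of $\pi_c-\pi_{c'}$ is nonzero in $H^2_{\pi_{c'}}(S^2)$.
   Context: Let $S^2=\{x_1^2+x_2^2+x_3^2=1\}\subset\mathbb{R}^3$. Let $\pi$ be the rotation-invariant nondegenerate Poisson bivector field on $S^2$ such that $-\pi$ is the restriction to $S^2$ of $x_1\,\partial_{x_2}\wedge\partial_{x_3}+x_2\,\partial_{x_3}\wedge\partial_{x_1}+x_3\,\partial_{x_1}\wedge\partial_{x_2}$. In the stereographic coordinate $w=x+iy=(x_1-ix_2)/(1+x_3)$ on $S^2\setminus\{(0,0,-1)\}$ one has $\pi=\frac14(1+x^2+y^2)^2\,\partial_x\wedge\partial_y$ and $x_3=\frac{1-x^2-y^2}{1+x^2+y^2}$. For $c\in\mathbb{R}$ put $\pi_c=(c-x_3)\pi$. For $|c|<1$, $\pi_c$ vanishes exactly on the circle $\{x_3=c\}$ and is called a necklace Poisson structure. For a Poisson manifold $(P,\pi_P)$, the Poisson cohomology $H^\bullet_{\pi_P}(P)$ is the cohomology of the complex $(\mathfrak{X}^\bullet(P),d_{\pi_P}=[\pi_P,\cdot])$,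 where $\mathfrak{X}^k(P)$ is the space of smooth $k$-vector fields on $P$ and $[\cdot,\cdot]$ is the Schouten bracket. $H^2_{\pi_P}(P)$ is the space of nontrivial infinitesimal deformations of $\pi_P$; a deformation of $\pi_P$ in the direction of a bivector field $\sigma$ with $[\pi_P,\sigma]=0$ is nontrivial if $\sigma$ has nonzero class in $H^2_{\pi_P}(P)$. *)

(* Defs.v *)
From HB Require Import structures.
From mathcomp Require Import all_boot all_order all_algebra all_fingroup.
From mathcomp Require Import all_classical all_reals all_analysis.
From mathcomp Require Import ring lra.

Set Implicit Arguments.
Unset Strict Implicit.
Unset Printing Implicit Defensive.

Import Order.TTheory GRing.Theory Num.Theory.
Import numFieldNormedType.Exports.

Local Open Scope classical_set_scope.
Local Open Scope ring_scope.

(******************************************************************************)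
(* Multivector fields, the Schouten bracket and Poisson cohomology.           *)
(*                                                                            *)
(* A stands for the algebra C^oo(M) of smooth functions on a manifold M. A    *)
(* k-vector field P on M is identified with the k-linear alternating map      *)
(* (f_1, ..., f_k) |-> P(df_1, ..., df_k) from A^k to A; these maps are       *)
(* exactly those which are a derivation in each argument.                     *)
(******************************************************************************)

Section PoissonCohomology.
Variables (R : comNzRingType) (A : comAlgType R).

Definition multimap (k : nat) := ('I_k -> A) -> A.

Definition update k (f : 'I_k -> A) (i : 'I_k) (a : A) : 'I_k -> A :=
  fun j => if j == i then a else f j.

Definition multilinear k (P : multimap k) : Prop :=
  forall (f : 'I_k -> A) i (r : R) (a b : A),
    P (update f i (r *: a + b)) = r *: P (update f i a) + P (update f i b).

Definition alternating k (P : multimap k) : Prop :=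
  forall (f : 'I_k -> A) i j, i != j -> f i = f j -> P f = 0.

Definition multiderivation k (P : multimap k) : Prop :=
  forall (f : 'I_k -> A) i (a b : A),
    P (update f i (a * b)) = a * P (update f i b) + b * P (update f i a).

Definition multivector_fields k : set (multimap k) :=
  [set P | [/\ multilinear P, alternating P & multiderivation P]].

(* (a P)(f_1, ..., f_k) = a P(f_1, ..., f_k) *)
Definition mulmv k (a : A) (P : multimap k) : multimap k :=
  fun f => a * P f.

(* (q, n - q)-shuffles: increasing on {0, ..., q-1} and on {q, ..., n-1} *)
Definition shuffle q n (s : 'S_n) : bool :=
  [forall i : 'I_n, forall j : 'I_n,
     ((i < j < q) || (q <= i < j))%N ==> (s i < s j)%N].

(* f_(s(m)); the value 0 for m >= n is never used in [insertion] below *)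
Definition permuted n (f : 'I_n -> A) (s : 'S_n) (m : nat) : A :=
  if insub m is Some i then f (s i) else 0.

(* For P of degree p, Q of degree q and n = p + q - 1:
     sum over the (q, p - 1)-shuffles s of
       sgn(s) P(Q(f_s(1), ..., f_s(q)), f_s(q+1), ..., f_s(q+p-1)),
   which is 0 when P is a function. *)
Definition insertion p q n (P : multimap p) (Q : multimap q) : multimap n :=
  fun f => if p is 0 then 0 else
    \sum_(s : 'S_n | shuffle q s) (-1) ^+ s *
      P (fun i : 'I_p => if i == 0%N :> nat
                         then Q (fun j : 'I_q => permuted f s j)
                         else permuted f s (q + i.-1)).

(* [P, Q] = P o Q - (-1)^((p-1)(q-1)) Q o P; the exponent is written
   (p + 1)(q + 1), which has the same parity, to avoid truncated subtraction. *)
Definition schouten p q (P : multimap p) (Q : multimap q) :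
    multimap (p + q).-1 :=
  (insertion P Q : multimap (p + q).-1)
    - mulmv ((-1) ^+ (p.+1 * q.+1)) (insertion Q P).

Definition dpi (pi : multimap 2) k (P : multimap k) : multimap k.+1 :=
  schouten pi P.

Definition cocycles (pi : multimap 2) k : set (multimap k) :=
  [set P | multivector_fields P /\ dpi pi P = 0].

Definition coboundaries (pi : multimap 2) k : set (multimap k) :=
  match k with
  | 0 => [set 0]
  | k'.+1 => [set dpi pi P | P in @multivector_fields k']
  end.

Arguments cocycles pi k P : clear implicits.
Arguments coboundaries pi k P : clear implicits.

(* The class of a cocycle P in H^k = Z^k / B^k, as the coset P + B^k. *)
Definition cohomology_class (pi : multimap 2) k (P : multimap k) :
    set (multimap k) :=
  [set Q | coboundaries pi k (Q - P)].

(* sigma is a cocycle and its class in H^2 is not the zero class *)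
Definition nontrivial_deformation (pi sigma : multimap 2) : Prop :=
  cocycles pi 2 sigma /\ cohomology_class pi sigma <> cohomology_class pi 0.

End PoissonCohomology.

Arguments multivector_fields {R} A k P.
Arguments cocycles {R A} pi k P.
Arguments coboundaries {R A} pi k P.

(******************************************************************************)
(* Smooth functions on open subsets of R^d.                                   *)
(******************************************************************************)

Section SmoothEuclidean.
Variables (R : realType) (d : nat).
Implicit Types (U V : set 'rV[R]_d) (F G : 'rV[R]_d -> R).

Definition partial F (i : 'I_d) : 'rV[R]_d -> R := 'D_('e_i) F.

(* F is of class C^n on the open set U. *)
Fixpoint Cn (n : nat) U F : Prop :=
  match n with
  | 0 => forall x, U x -> {for x, continuous F}
  | n'.+1 => (forall x, U x -> differentiable F x) /\
             (forall i, Cn n' U (partial F i))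
  end.

Definition smooth_on U F : Prop := forall n, Cn n U F.

Lemma CnW n U F : Cn n.+1 U F -> Cn n U F.
Proof.
elim: n F => [F [dF _] x Ux|n IH F [dF pF]].
  exact/differentiable_continuous/dF.
by split=> // i; exact: IH.
Qed.

Lemma sub_Cn n U V F : V `<=` U -> Cn n U F -> Cn n V F.
Proof.
move=> VU; elim: n F => [F cF x Vx|n IH F [dF pF]]; first exact/cF/VU.
by split=> [x Vx|i]; [exact/dF/VU|exact/IH/pF].
Qed.

Lemma near_eq_differentiable F G x :
  {near x, F =1 G} -> differentiable F x -> differentiable G x.
Proof.
move=> FG /diff_locallyP[cF eF]; apply/diff_locallyP.
have eG : G \o shift x = cst (G x) + 'd F x +o_ 0 id.
  apply/eqaddoP => e e0.
  have /eqaddoP/(_ _ e0) hF := eF.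
  have FG0 : \forall y \near (0 : 'rV[R]_d), F (y + x) = G (y + x).
    by move: FG; rewrite (near_shift 0 x) /= subr0.
  apply: filterS2 FG0 hF => y.
  by rewrite !fctE /= -(nbhs_singleton FG) => ->.
by rewrite (diff_unique cF eG).
Qed.

Lemma eq_Cn n U F G :
  open U -> (forall x, U x -> F x = G x) -> Cn n U F -> Cn n U G.
Proof.
move=> oU; elim: n F G => [|n IH] F G FG;
  have near_FG x : U x -> {near x, F =1 G}
    by move=> Ux; near=> y; apply: FG; near: y; exact: open_nbhs_nbhs.
  move=> cF x Ux; rewrite /prop_for /continuous_at -FG//.
  exact: cvg_trans (near_eq_cvg (near_FG x Ux)) (cF x Ux).
move=> [dF pF]; split=> [x Ux|i].
  exact: near_eq_differentiable (near_FG _ Ux) (dF _ Ux).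
by apply: IH (pF i) => x Ux; apply/near_eq_derive/near_FG.
Unshelve. all: by end_near. Qed.

Lemma Cn_cst n U (c : R) : Cn n U (fun=> c).
Proof.
elim: n c => [c x _|n IH c]; first exact: cst_continuous.
split=> [x _|i]; first exact: differentiable_cst.
suff -> : partial (fun=> c) i = fun=> 0 by exact: IH.
by apply/funext => x; rewrite /partial derive_cst.
Qed.

Lemma CnD n U F G : open U -> Cn n U F -> Cn n U G -> Cn n U (F + G).
Proof.
move=> oU; elim: n F G => [F G cF cG x Ux|n IH F G [dF pF] [dG pG]].
  exact: (@continuousD _ _ _ F G x (cF x Ux) (cG x Ux)).
split=> [x Ux|i]; first by apply: differentiableD; [exact: dF|exact: dG].
apply: (eq_Cn oU _ (IH _ _ (pF i) (pG i))) => x Ux.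
by rewrite /partial deriveD//; apply: diff_derivable; [exact: dF|exact: dG].
Qed.

Lemma CnM n U F G : open U -> Cn n U F -> Cn n U G -> Cn n U (F * G).
Proof.
move=> oU; elim: n F G => [F G cF cG x Ux|n IH F G sF sG].
  exact: (@continuousM _ _ F G x (cF x Ux) (cG x Ux)).
have [[dF pF] [dG pG]] := (sF, sG).
split=> [x Ux|i]; first by apply: differentiableM; [exact: dF|exact: dG].
have h := CnD oU (IH _ _ (CnW sF) (pG i)) (IH _ _ (CnW sG) (pF i)).
apply: (eq_Cn oU _ h) => x Ux.
by rewrite /partial deriveM//; apply: diff_derivable; [exact: dF|exact: dG].
Qed.

Lemma Cn_coord n U (j : 'I_d) : Cn n U (fun x : 'rV[R]_d => x 0 j).
Proof.
case: n => [x _|n]; first exact: coord_continuous.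
split=> [x _|i]; first exact: differentiable_coord.
suff -> : partial (fun x : 'rV[R]_d => x 0 j) i =
    fun=> (delta_mx 0 i : 'rV[R]_d) 0 j by exact: Cn_cst.
apply/funext => x; rewrite /partial deriveE; last exact: differentiable_coord.
have lin_j : linear (fun y : 'rV[R]_d => y 0 j) by move=> c y z; rewrite !mxE.
pose mj := GRing.isLinear.Build _ _ _ _ _ lin_j.
pose fj : {linear 'rV[R]_d -> R} := HB.pack (fun y : 'rV[R]_d => y 0 j) mj.
by rewrite -[fun _ => _]/(fj : _ -> _) diff_lin//; exact: coord_continuous.
Qed.

End SmoothEuclidean.

(******************************************************************************)
(* The unit sphere S^2 in R^3 and its algebra of smooth functions.            *)
(******************************************************************************)

Definition sphere (R : realType) : Type :=
  {p : 'rV[R]_3 | \sum_(i < 3) p 0 i ^+ 2 == 1}.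

Section Sphere.
Variable R : realType.

HB.instance Definition _ := Choice.on (sphere R).

Fact north_pole_subproof :
  \sum_(i < 3) (delta_mx 0 (inord 2) : 'rV[R]_3) 0 i ^+ 2 == 1.
Proof.
rewrite (bigD1 (inord 2))//= big1 ?mxE ?eqxx ?expr1n ?addr0// => i i2.
by rewrite mxE (negbTE i2) andbF expr0n.
Qed.

Definition north_pole : sphere R := 
  exist (fun p : 'rV[R]_3 => \sum_(i < 3) p 0 i ^+ 2 == 1) _
    north_pole_subproof.

HB.instance Definition _ := isPointed.Build (sphere R) north_pole.

(* F is a smooth function on a neighbourhood of p in R^3 which coincides with
   f on the sphere. *)
Definition extends_near (f : sphere R -> R) (p : sphere R)
    (F : 'rV[R]_3 -> R) : Prop :=
  exists U, [/\ open U, U (val p), smooth_on U F &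
                forall q : sphere R, U (val q) -> f q = F (val q)].

Definition smooth_function (f : sphere R -> R) : Prop :=
  forall p, exists F, extends_near f p F.

Definition smooth : {pred sphere R -> R} := fun f => `[< smooth_function f >].

Lemma extends_near_cst c p : extends_near (cst c) p (cst c).
Proof.
by exists setT; split=> // [|n]; [exact: openT|exact: Cn_cst].
Qed.

Lemma extends_nearD f g p F G :
  extends_near f p F -> extends_near g p G -> extends_near (f + g) p (F + G).
Proof.
move=> [U [oU Up sF eF]] [V [oV Vp sG eG]]; exists (U `&` V).
have oUV := openI oU oV.
split=> // [n|q [Uq Vq]]; last by rewrite !fctE eF ?eG.
by apply: CnD => //; [apply: sub_Cn (sF n)|apply: sub_Cn (sG n)] => x [].
Qed.

Lemma extends_nearM f g p F G :
  extends_near f p F -> extends_near g p G -> extends_near (f * g) p (F * G).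
Proof.
move=> [U [oU Up sF eF]] [V [oV Vp sG eG]]; exists (U `&` V).
have oUV := openI oU oV.
split=> // [n|q [Uq Vq]]; last by rewrite !fctE eF ?eG.
by apply: CnM => //; [apply: sub_Cn (sF n)|apply: sub_Cn (sG n)] => x [].
Qed.

Lemma smooth_cst c : cst c \in smooth.
Proof. by apply/asboolP => p; exists (cst c); exact: extends_near_cst. Qed.

Lemma smoothM f g : f \in smooth -> g \in smooth -> f * g \in smooth.
Proof.
move=> /asboolP sf /asboolP sg; apply/asboolP => p.
have [[F hF] [G hG]] := (sf p, sg p).
by exists (F * G); exact: extends_nearM.
Qed.

Lemma smoothD f g : f \in smooth -> g \in smooth -> f + g \in smooth.
Proof.
move=> /asboolP sf /asboolP sg; apply/asboolP => p.
have [[F hF] [G hG]] := (sf p, sg p).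
by exists (F + G); exact: extends_nearD.
Qed.

Lemma smoothZ c f : f \in smooth -> c *: f \in smooth.
Proof. by move=> sf; exact: (smoothM (smooth_cst c) sf). Qed.

Fact smooth_subring_closed : subring_closed smooth.
Proof.
split=> [|f g sf sg|f g]; [exact: (smooth_cst 1)| |exact: smoothM].
by apply: smoothD => //; rewrite -scaleN1r; exact: smoothZ.
Qed.
HB.instance Definition _ :=
  GRing.isSubringClosed.Build (sphere R -> R) smooth smooth_subring_closed.

Fact smooth_scaler_closed : GRing.scaler_closed smooth.
Proof. by move=> c f; exact: smoothZ. Qed.
HB.instance Definition _ :=
  GRing.isScaleClosed.Build R (sphere R -> R) smooth smooth_scaler_closed.

Definition Cinf : Type := {f : sphere R -> R | f \in smooth}.

Definition mkCinf (f : sphere R -> R) (sf : f \in smooth) : Cinf :=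
  exist (fun f => f \in smooth) f sf.

HB.instance Definition _ := SubChoice.on Cinf.
HB.instance Definition _ := [SubChoice_isSubComNzRing of Cinf by <:].
HB.instance Definition _ := [SubZmodule_isSubLmodule of Cinf by <:].

Fact Cinf_scalerAl (c : R) (f g : Cinf) : c *: (f * g) = c *: f * g.
Proof. by apply/val_inj/funext => p /=; exact: mulrA. Qed.
HB.instance Definition _ := GRing.Lmodule_isLalgebra.Build R Cinf Cinf_scalerAl.
HB.instance Definition _ := GRing.Lalgebra_isComAlgebra.Build R Cinf.

Lemma curve_coefficients (m : R) :
  is_derive (0 : R) 1 (fun t : R => (1 - m * t ^+ 2) / (1 + m * t ^+ 2)) 0 /\
  is_derive (0 : R) 1 (fun t : R => 2 * t / (1 + m * t ^+ 2)) 2.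
Proof.
have den0 : (fun t : R => 1 + m * t ^+ 2) 0 != 0.
  by rewrite expr0n mulr0 addr0 oner_neq0.
have dsq : is_derive (0 : R) 1 (m *: (id : R -> R) ^+ 2) 0.
  have := is_deriveZ m (is_deriveX 2 (is_derive_id (0 : R) (1 : R))).
  by rewrite expr1 mulr0 scale0r scaler0.
have dden : is_derive (0 : R) 1 (fun t : R => 1 + m * t ^+ 2) 0.
  have := is_deriveD (is_derive_cst (1 : R) (0 : R) (1 : R)) dsq.
  by rewrite addr0.
have dinv := @is_deriveV R (fun t => 1 + m * t ^+ 2) 0 0 1 den0 dden.
rewrite scaler0 in dinv.
split.
  have dnum := is_deriveB (is_derive_cst (1 : R) (0 : R) (1 : R)) dsq.
  by have := is_deriveM dnum dinv; rewrite subr0 !scaler0 addr0.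
have dnum := is_deriveZ (2 : R) (is_derive_id (0 : R) (1 : R)).
have := is_deriveM dnum dinv.
rewrite expr0n mulr0 addr0 invr1 scale1r scaler0 add0r.
by rewrite -[2%:A]/(2 * 1) mulr1.
Qed.

Lemma diff_curve (V : normedModType R) (a b : R -> R) (da db : R)
    (p w : V) :
  is_derive (0 : R) 1 a da -> is_derive (0 : R) 1 b db ->
  let y := fun t : R => a t *: p + b t *: w in
  differentiable y 0 /\ 'd y 0 1 = da *: p + db *: w.
Proof.
move=> ha hb.
have day : differentiable a 0 by apply/derivable1_diffP.
have dby : differentiable b 0 by apply/derivable1_diffP.
have dap : differentiable (fun t => a t *: p) 0 by exact: differentiableZl.
have dbw : differentiable (fun t => b t *: w) 0 by exact: differentiableZl.
split; first exact: differentiableD.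
rewrite (diffD dap dbw) /= (diffZl p day) (diffZl w dby).
by rewrite -(deriveE (1 : R) day) -(deriveE (1 : R) dby) !derive_val.
Qed.

(* A rational curve on the sphere through q with velocity 2 w at t = 0. *)
Lemma sphere_curve (q : sphere R) (w : 'rV[R]_3) (t : R) :
  \sum_(i < 3) w 0 i * val q 0 i = 0 ->
  let m := \sum_(i < 3) w 0 i ^+ 2 in
  let y := ((1 - m * t ^+ 2) / (1 + m * t ^+ 2)) *: val q
           + (2 * t / (1 + m * t ^+ 2)) *: w in
  \sum_(i < 3) y 0 i ^+ 2 = 1.
Proof.
move=> wq m y; move: (valP q) => /eqP q1.
have m0 : 0 <= m by apply: sumr_ge0 => i _; exact: sqr_ge0.
have d0 : 1 + m * t ^+ 2 != 0.
  by rewrite gt_eqF// ltr_pwDl// mulr_ge0// sqr_ge0.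
pose a := (1 - m * t ^+ 2) / (1 + m * t ^+ 2); pose b := 2 * t / (1 + m * t ^+ 2).
have -> : \sum_(i < 3) y 0 i ^+ 2 = a ^+ 2 * (\sum_(i < 3) val q 0 i ^+ 2)
    + (2 * a * b) * (\sum_(i < 3) w 0 i * val q 0 i) + b ^+ 2 * m.
  rewrite !big_distrr -!big_split /=; apply: eq_bigr => i _.
  by rewrite /y !mxE -/a -/b; ring.
by rewrite q1 wq /a /b; field.
Qed.

(* Two functions which agree on the sphere near q have the same derivatives
   along vectors tangent to the sphere at q. *)
Lemma extends_near_tangent (f : sphere R -> R) (q : sphere R) F G
    (w : 'rV[R]_3) :
  extends_near f q F -> extends_near f q G ->
  \sum_(i < 3) w 0 i * val q 0 i = 0 ->
  \sum_(i < 3) w 0 i * partial F i (val q)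
    = \sum_(i < 3) w 0 i * partial G i (val q).
Proof.
move=> [U [oU Uq sF eF]] [V [oV Vq sG eG]] wq.
set p := val q in Uq Vq wq *.
have dF : differentiable F p by have [dF _] := sF 1%N; exact: dF.
have dG : differentiable G p by have [dG _] := sG 1%N; exact: dG.
have dsum (H : 'rV[R]_3 -> R) : differentiable H p ->
    \sum_(i < 3) w 0 i * partial H i p = 'd H p w.
  move=> dH; rewrite [in RHS](row_sum_delta w) linear_sum /=.
  by apply: eq_bigr => i _; rewrite linearZ /= /partial deriveE.
rewrite (dsum F dF) (dsum G dG).
pose m := \sum_(i < 3) w 0 i ^+ 2.
pose a (t : R) := (1 - m * t ^+ 2) / (1 + m * t ^+ 2).
pose b (t : R) := 2 * t / (1 + m * t ^+ 2).
pose y (t : R) : 'rV[R]_3 := a t *: p + b t *: w.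
have y0 : y 0 = p.
  by rewrite /y /a /b expr0n /= !mulr0 subr0 addr0 invr1
    !(mul0r, mulr1) scale1r scale0r addr0.
have [da db] := curve_coefficients m.
have [dy vy] := diff_curve p w da db; rewrite scale0r add0r in vy.
have cy : {for 0, continuous y} by exact: differentiable_continuous.
have FGy : \forall t \near (0 : R), (F \o y) t = (G \o y) t.
  have nU : \forall t \near (0 : R), U (y t).
    by apply: cy; rewrite y0; exact: open_nbhs_nbhs.
  have nV : \forall t \near (0 : R), V (y t).
    by apply: cy; rewrite y0; exact: open_nbhs_nbhs.
  apply: filterS2 nU nV => t Ut Vt.
  pose yt : sphere R := exist (fun p : 'rV[R]_3 => \sum_(i < 3) p 0 i ^+ 2 == 1)
    (y t) (introT eqP (sphere_curve t wq)).
  by rewrite /= -(eF yt)// -(eG yt).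
have chain (H : 'rV[R]_3 -> R) : differentiable H p ->
    'D_1 (H \o y) 0 = 2 * ('d H p w : R).
  move=> dH; rewrite deriveE; last by apply: differentiable_comp; rewrite ?y0.
  by rewrite diff_comp ?y0//= vy linearZ.
have := near_eq_derive (1 : R) FGy.
rewrite (chain F dF) (chain G dG) => /mulfI; apply; exact: lt0r_neq0.
Qed.

Lemma sum_ord3 (f : 'I_3 -> R) : \sum_(i < 3) f i = f 0 + f 1 + f 2.
Proof.
rewrite 3!big_ord_recl big_ord0 addr0 addrA.
by congr (f _ + f _ + f _); exact: val_inj.
Qed.

(* (d_i /\ d_j)(F, G) *)
Definition wedge (i j : 'I_3) (F G : 'rV[R]_3 -> R) : 'rV[R]_3 -> R :=
  fun x => partial F i x * partial G j x - partial F j x * partial G i x.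

(* The bivector field x_1 d_2 /\ d_3 + x_2 d_3 /\ d_1 + x_3 d_1 /\ d_2 on R^3,
   evaluated on (F, G); the coordinates x_1, x_2, x_3 have indices 0, 1, 2. *)
Definition rot_bivector (F G : 'rV[R]_3 -> R) : 'rV[R]_3 -> R :=
  fun x => x 0 0 * wedge 1 2 F G x + x 0 1 * wedge 2 0 F G x
           + x 0 2 * wedge 0 1 F G x.

Lemma rot_bivectorC F G x : rot_bivector G F x = - rot_bivector F G x.
Proof. rewrite /rot_bivector /wedge.
move: (x 0 0) (x 0 1) (x 0 2) (partial F 0 x) (partial F 1 x) (partial F 2 x)
  (partial G 0 x) (partial G 1 x) (partial G 2 x).
by move=> x0 x1 x2 f0 f1 f2 g0 g1 g2; ring. Qed.

(* The value at p of the restriction of [rot_bivector] to the sphere depends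
   only on the restrictions of F and G. *)
Lemma rot_bivector_restrl f (p : sphere R) F F' G :
  extends_near f p F -> extends_near f p F' ->
  rot_bivector F G (val p) = rot_bivector F' G (val p).
Proof.
move=> eF eF'; set x := val p.
pose w := \row_(i < 3) (x 0 (i - 1) * partial G (i + 1) x
                        - x 0 (i + 1) * partial G (i - 1) x).
have i01 : 0 - 1 = 2 :> 'I_3 by exact: val_inj.
have i12 : 1 + 1 = 2 :> 'I_3 by exact: val_inj.
have i21 : 2 - 1 = 1 :> 'I_3 by exact: val_inj.
have i20 : 2 + 1 = 0 :> 'I_3 by exact: val_inj.
pose i3 := (i01, i12, i21, i20, subrr (1 : 'I_3), add0r (1 : 'I_3)).
have wx : \sum_(i < 3) w 0 i * val p 0 i = 0.
  rewrite sum_ord3 !mxE -/x !i3.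
  move: (x 0 0) (x 0 1) (x 0 2) (partial G 0 x) (partial G 1 x) (partial G 2 x).
  by move=> x0 x1 x2 g0 g1 g2; ring.
have rotE H : rot_bivector H G x = \sum_(i < 3) w 0 i * partial H i x.
  rewrite sum_ord3 !mxE !i3 /rot_bivector /wedge.
  move: (x 0 0) (x 0 1) (x 0 2) (partial H 0 x) (partial H 1 x) (partial H 2 x)
    (partial G 0 x) (partial G 1 x) (partial G 2 x).
  by move=> x0 x1 x2 f0 f1 f2 g0 g1 g2; ring.
by rewrite !rotE; exact: extends_near_tangent eF eF' wx.
Qed.

Lemma rot_bivector_restr f g (p : sphere R) F F' G G' :
  extends_near f p F -> extends_near f p F' ->
  extends_near g p G -> extends_near g p G' ->
  rot_bivector F G (val p) = rot_bivector F' G' (val p).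
Proof.
move=> eF eF' eG eG'; rewrite (rot_bivector_restrl G eF eF').
by rewrite rot_bivectorC (rot_bivector_restrl F' eG eG') -rot_bivectorC.
Qed.

Lemma smooth_partial (U : set 'rV[R]_3) F i n :
  smooth_on U F -> Cn n U (partial F i).
Proof. by move=> sF; have [_ pF] := sF n.+1; exact: pF. Qed.

Lemma smooth_rot_bivector (U : set 'rV[R]_3) F G :
  open U -> smooth_on U F -> smooth_on U G -> smooth_on U (rot_bivector F G).
Proof.
move=> oU sF sG n.
have sw i j : Cn n U (wedge i j F G).
  rewrite -[wedge _ _ _ _]/(partial F i * partial G j
    - partial F j * partial G i) -mulN1r; apply: CnD => //.
    by apply: CnM => //; exact: smooth_partial.
  apply: CnM => //; first exact: (Cn_cst n U (-1)).
  by apply: CnM => //; exact: smooth_partial.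
pose x_ i : 'rV[R]_3 -> R := fun x => x 0 i.
rewrite -[rot_bivector F G]/(x_ 0 * wedge 1 2 F G + x_ 1 * wedge 2 0 F G
  + x_ 2 * wedge 0 1 F G).
by do ![apply: CnD => //]; apply: CnM => //; exact: Cn_coord.
Qed.

Definition extension (f : Cinf) (p : sphere R) : 'rV[R]_3 -> R :=
  sval (cid (asboolW (valP f) p)).

Lemma extensionP (f : Cinf) p : extends_near (val f) p (extension f p).
Proof. exact: svalP (cid _). Qed.

Fact pi_bracket_subproof (f g : Cinf) :
  (fun p => - rot_bivector (extension f p) (extension g p) (val p)) \in smooth.
Proof.
apply/asboolP => p.
have [U [oU Up sF eF]] := extensionP f p.
have [V [oV Vp sG eG]] := extensionP g p.
exists (cst (- 1) * rot_bivector (extension f p) (extension g p)), (U `&` V).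
have oUV := openI oU oV.
split=> // [n|q [Uq Vq]].
  apply: CnM => //; first exact: Cn_cst.
  apply: smooth_rot_bivector => // k.
    by apply: sub_Cn (sF k) => x [].
  by apply: sub_Cn (sG k) => x [].
rewrite fctE mulN1r; congr (- _).
apply: rot_bivector_restr (extensionP _ _) _ (extensionP _ _) _.
  by exists U.
by exists V.
Qed.

(* - pi is the restriction of [rot_bivector] to the sphere. *)
Definition pi_bracket (f g : Cinf) : Cinf := mkCinf (pi_bracket_subproof f g).

Lemma pi_bracketE (f g : Cinf) p F G :
  extends_near (val f) p F -> extends_near (val g) p G ->
  - val (pi_bracket f g) p = rot_bivector F G (val p).
Proof.
move=> eF eG; rewrite /= opprK.
exact: rot_bivector_restr (extensionP _ _) eF (extensionP _ _) eG.
Qed.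

Definition sphere_pi : multimap Cinf 2 := fun f => pi_bracket (f 0) (f 1).

Fact coord_subproof (i : 'I_3) : (fun p : sphere R => val p 0 i) \in smooth.
Proof.
apply/asboolP => p; exists (fun x => x 0 i), setT.
by split=> // [|n]; [exact: openT|exact: Cn_coord].
Qed.

Definition coord (i : 'I_3) : Cinf := mkCinf (coord_subproof i).

(* pi_c = (c - x_3) pi *)
Definition necklace (c : R) : multimap Cinf 2 :=
  mulmv (c%:A - coord 2) sphere_pi.

End Sphere.

(* Main.v *)
Require Import Defs.
From HB Require Import structures.
From mathcomp Require Import all_boot all_order all_algebra all_fingroup.
From mathcomp Require Import all_classical all_reals all_analysis.
From mathcomp Require Import ring lra.

Set Implicit Arguments.
Unset Strict Implicit.
Unset Printing Implicit Defensive.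

Import Order.TTheory GRing.Theory Num.Theory.
Import numFieldNormedType.Exports.

(* Suppose that [pi_c, X] = a pi for a vector field X. In spherical coordinates
   (t, th), with x_3 = cos t, average the function X(x_3) over the circles of
   latitude to get a smooth function Phi of t which vanishes at the poles. The
   divergence of X averages to a t-derivative, so the equation becomes
     (c - cos t) Phi' = sin t (Phi - a).
   Hence Phi - a is a multiple of c - cos t on each side of the circle
   cos t = c, and differentiability across the circle makes the two multiples
   equal. But at the poles Phi - a = - a while c - cos t takes the two different
   values c - 1 and c + 1, so a = 0.

   That pi is a cocycle for pi_c follows from the Jacobi identity of pi and from
   the Pluecker relation {f,g}{h,u} + {g,h}{f,u} + {h,f}{g,u} = 0, which
   expresses that the sphere has dimension 2. *)

Local Open Scope classical_set_scope.
Local Open Scope ring_scope.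

(** * Symmetry of second partial derivatives *)

Section Partials.
Variables (R : realType) (d : nat).
Implicit Types (U : set 'rV[R]_d) (F G : 'rV[R]_d -> R) (x v : 'rV[R]_d).

Lemma is_derive_line F x v (t : R) :
  derivable F (x + t *: v) v ->
  is_derive t 1 (fun s => F (x + s *: v)) ('D_v F (x + t *: v)).
Proof.
move=> dF.
have E : (fun h : R => h^-1 *: (((fun s => F (x + s *: v)) \o shift t) (h *: 1)
      - F (x + t *: v))) =
    (fun h : R => h^-1 *: ((F \o shift (x + t *: v)) (h *: v) - F (x + t *: v))).
  apply/funext => h /=; congr (_ *: (F _ - _)).
  by rewrite scalerDl addrCA -[h *: 1]/(h * 1) mulr1.
by split; rewrite /derivable /derive E.
Qed.

Lemma partialD F G i x : differentiable F x -> differentiable G x ->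
  partial (F + G) i x = partial F i x + partial G i x.
Proof. by move=> dF dG; rewrite /partial deriveD//; exact: diff_derivable. Qed.

Lemma partialB F G i x : differentiable F x -> differentiable G x ->
  partial (F - G) i x = partial F i x - partial G i x.
Proof. by move=> dF dG; rewrite /partial deriveB//; exact: diff_derivable. Qed.

Lemma partialM F G i x : differentiable F x -> differentiable G x ->
  partial (F * G) i x = F x * partial G i x + G x * partial F i x.
Proof. by move=> dF dG; rewrite /partial deriveM//; exact: diff_derivable. Qed.

Lemma partial_cst c i x : partial (cst c : 'rV[R]_d -> R) i x = 0.
Proof. by rewrite /partial derive_cst. Qed.

Lemma partial_coord (j : 'I_d) i x :
  partial (fun y : 'rV[R]_d => y 0 j) i x = (i == j)%:R.
Proof.
rewrite /partial deriveE; last exact: differentiable_coord.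
have lin_j : linear (fun y : 'rV[R]_d => y 0 j) by move=> c y z; rewrite !mxE.
pose mj := GRing.isLinear.Build _ _ _ _ _ lin_j.
pose fj : {linear 'rV[R]_d -> R} := HB.pack (fun y : 'rV[R]_d => y 0 j) mj.
rewrite -[fun _ => _]/(fj : _ -> _) diff_lin; last exact: coord_continuous.
by rewrite /fj /= mxE eqxx eq_sym.
Qed.

Lemma smooth_differentiable U F x : smooth_on U F -> U x -> differentiable F x.
Proof. by move=> sF Ux; have [dF _] := sF 1%N; exact: dF. Qed.

Lemma smooth_on_partial U F i : smooth_on U F -> smooth_on U (partial F i).
Proof. by move=> sF n; have [_ pF] := sF n.+1; exact: pF. Qed.

(* Two applications of the mean value theorem to the second difference of F
   over a square of side h. *)
Lemma second_difference U F i j x (h : R) : smooth_on U F -> 0 < h ->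
  (forall s t, 0 <= s <= h -> 0 <= t <= h -> U (x + s *: 'e_i + t *: 'e_j)) ->
  exists s t, [/\ 0 <= s <= h, 0 <= t <= h &
    F (x + h *: 'e_i + h *: 'e_j) - F (x + h *: 'e_i) - F (x + h *: 'e_j) + F x
    = h ^+ 2 * partial (partial F i) j (x + s *: 'e_i + t *: 'e_j)].
Proof.
move=> sF h0 Uh.
have hh : 0 <= h <= h by rewrite ltW /=.
have h00 : 0 <= (0 : R) <= h by rewrite lexx /= ltW.
have dline G y v t : differentiable G (y + t *: v) ->
    is_derive t 1 (fun s => G (y + s *: v)) ('D_v G (y + t *: v)).
  by move=> dG; apply: is_derive_line; exact: diff_derivable.
(* The second difference is [phi h - phi 0]. The mean value theorem in [s] turns it into [h] times
   an increment of [psi], to which the theorem is applied again. *)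
pose phi (s : R) := F (x + h *: 'e_j + s *: 'e_i) - F (x + s *: 'e_i).
have dphi (s : R) : 0 <= s <= h -> is_derive s 1 phi
    (partial F i (x + h *: 'e_j + s *: 'e_i) - partial F i (x + s *: 'e_i)).
  move=> sh; apply: is_deriveB; apply: dline; apply: smooth_differentiable sF _.
    by rewrite addrAC; exact: Uh.
  by have := Uh s 0 sh h00; rewrite scale0r addr0.
have itvP (s : R) : s \in `]0, h[ -> 0 <= s <= h.
  by rewrite in_itv/= => /andP[? ?]; rewrite !ltW.
have [s /itvP sh Es] : exists2 s, s \in `]0, h[ & phi h - phi 0 =
    (partial F i (x + h *: 'e_j + s *: 'e_i) - partial F i (x + s *: 'e_i)) * (h - 0).
  apply: (MVT h0 (df := fun s => partial F i (x + h *: 'e_j + s *: 'e_i)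
      - partial F i (x + s *: 'e_i))) => [s /itvP|]; first exact: dphi.
  apply: derivable_within_continuous => s; rewrite in_itv/= => sh.
  by have [] := dphi s sh.
pose psi (t : R) := partial F i (x + s *: 'e_i + t *: 'e_j).
have dpsi (t : R) : 0 <= t <= h -> is_derive t 1 psi
    (partial (partial F i) j (x + s *: 'e_i + t *: 'e_j)).
  move=> th; apply: dline; apply: smooth_differentiable (smooth_on_partial i sF) _.
  exact: Uh.
have [t /itvP th Et] : exists2 t, t \in `]0, h[ & psi h - psi 0 =
    partial (partial F i) j (x + s *: 'e_i + t *: 'e_j) * (h - 0).
  apply: (MVT h0 (df := fun t => partial (partial F i) j
     (x + s *: 'e_i + t *: 'e_j))) => [t /itvP|]; first exact: dpsi.
  apply: derivable_within_continuous => t; rewrite in_itv/= => th.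
  by have [] := dpsi t th.
exists s, t; split=> //.
rewrite subr0 in Es Et.
have -> : h ^+ 2 * partial (partial F i) j (x + s *: 'e_i + t *: 'e_j)
    = (psi h - psi 0) * h by rewrite Et; ring.
rewrite /psi scale0r addr0 [x + s *: _ + _]addrAC -Es /phi.
rewrite scale0r !addr0 [x + h *: 'e_j + _]addrAC opprB addrA.
exact: addrAC.
Qed.

Lemma ler_dist_half (a b m e : R) :
  `|a - m| < e / 2 -> `|b - m| < e / 2 -> `|a - b| <= e.
Proof.
rewrite !ltr_norml => /andP[? ?] /andP[? ?]; rewrite ler_norml.
by apply/andP; split; lra.
Qed.

(** The second difference over a square is symmetric in [i] and [j]. Hence on any small square at
    [x] the two mixed partials take a common value, at possibly different points, and continuity at
    [x] concludes. *)
Lemma partialC U F i j x : open U -> smooth_on U F -> U x ->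
  partial (partial F i) j x = partial (partial F j) i x.
Proof.
move=> oU sF Ux; apply/eqP; rewrite -subr_eq0 -normr_le0.
apply/ler_addgt0Pl => e e0; rewrite addr0.
have near_x k l : \forall y \near x, `|partial (partial F k) l x
    - partial (partial F k) l y| < e / 2.
  have cF : {for x, continuous (partial (partial F k) l)}.
    apply: differentiable_continuous; apply: smooth_differentiable Ux.
    by do 2 apply: smooth_on_partial.
  by move/cvgrPdist_lt: cF; apply; rewrite divr_gt0.
have : \forall y \near x, [/\ U y,
    `|partial (partial F i) j x - partial (partial F i) j y| < e / 2 &
    `|partial (partial F j) i x - partial (partial F j) i y| < e / 2].
  by apply: filterS3 (open_nbhs_nbhs (conj oU Ux)) (near_x i j) (near_x j i).
move=> /nbhs_ballP[r /= r0 hr].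
(* Basis vectors have norm at most 1, so a square of side less than [r / 2] stays in the ball of
   radius [r]. *)
have near_sq k l : \forall h \near (0 : R)^'+, forall s t, 0 <= s <= h ->
    0 <= t <= h -> ball x r (x + s *: 'e_k + t *: 'e_l).
  near=> h => s t /andP[s0 sh] /andP[t0 th].
  rewrite -ball_normE /= opprD addrA opprD addrA subrr add0r -opprD normrN.
  have ne (m : 'I_d) : `|'e_m : 'rV[R]_d| <= 1.
    rewrite [leLHS]mx_normrE; apply: bigmax_le => // -[a b] _.
    by rewrite mxE; case: (_ && _); rewrite ?normr1 ?normr0.
  have hr2 : h < r / 2 by near: h; apply: nbhs_right_lt; rewrite divr_gt0.
  rewrite (le_lt_trans (ler_normD _ _))// (splitr r) ltrD//.
    by rewrite normrZ (ger0_norm s0) (le_lt_trans _ hr2)// (le_trans _ sh)// ler_piMr.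
  by rewrite normrZ (ger0_norm t0) (le_lt_trans _ hr2)// (le_trans _ th)// ler_piMr.
have [h [h0 hij hji]] : exists h : R, [/\ 0 < h, (forall s t, 0 <= s <= h ->
    0 <= t <= h -> ball x r (x + s *: 'e_i + t *: 'e_j)) &
    (forall s t, 0 <= s <= h ->
    0 <= t <= h -> ball x r (x + s *: 'e_j + t *: 'e_i))].
  near (0 : R)^'+ => h; exists h; split.
  - by near: h; exact: nbhs_right_gt.
  - by near: h; exact: near_sq.
  - by near: h; exact: near_sq.
have [|s [t [sh th Eij]]] := @second_difference U F i j x h sF h0.
  by move=> s t sh th; have [] := hr _ (hij s t sh th).
have [|s' [t' [sh' th' Eji]]] := @second_difference U F j i x h sF h0.
  by move=> s' t' sh' th'; have [] := hr _ (hji s' t' sh' th').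
have [_ bij _] := hr _ (hij s t sh th).
have [_ _ bji] := hr _ (hji s' t' sh' th').
have EE : partial (partial F i) j (x + s *: 'e_i + t *: 'e_j) =
    partial (partial F j) i (x + s' *: 'e_j + t' *: 'e_i).
  have h2 : h ^+ 2 != 0 by rewrite expf_neq0// gt_eqF.
  apply: (mulfI h2); apply: etrans (esym Eij) _; apply: etrans _ Eji.
  rewrite (addrAC x (h *: 'e_j)).
  move: (F _) (F (x + h *: 'e_i)) (F (x + h *: 'e_j)) => u v w.
  by rewrite (addrAC u).
rewrite -EE in bji.
exact: ler_dist_half bij bji.
Unshelve. all: by end_near. Qed.

End Partials.

(** * The rotation-invariant bracket on R^3 *)

Section Bracket.
Variable R : realType.
Implicit Types (f g h u : Cinf R) (p : sphere R) (F G H : 'rV[R]_3 -> R).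

Lemma partial_wedge U i j k F G (x : 'rV[R]_3) :
  smooth_on U F -> smooth_on U G -> U x ->
  partial (wedge i j F G) k x =
    (partial F i x * partial (partial G j) k x
     + partial G j x * partial (partial F i) k x)
    - (partial F j x * partial (partial G i) k x
       + partial G i x * partial (partial F j) k x).
Proof.
move=> sF sG Ux.
have dF l : differentiable (partial F l) x.
  exact: smooth_differentiable (smooth_on_partial l sF) Ux.
have dG l : differentiable (partial G l) x.
  exact: smooth_differentiable (smooth_on_partial l sG) Ux.
rewrite -[wedge _ _ _ _]/(partial F i * partial G j - partial F j * partial G i).
apply: etrans (partialB k (differentiableM (dF i) (dG j))
  (differentiableM (dF j) (dG i))) _.
exact: (congr2 (fun a b => a - b) (partialM k (dF i) (dG j)) (partialM k (dF j) (dG i))).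
Qed.

Lemma smooth_on_differentiable_wedge U i j F G (x : 'rV[R]_3) :
  smooth_on U F -> smooth_on U G -> U x -> differentiable (wedge i j F G) x.
Proof.
move=> sF sG Ux.
have dF l : differentiable (partial F l) x.
  exact: smooth_differentiable (smooth_on_partial l sF) Ux.
have dG l : differentiable (partial G l) x.
  exact: smooth_differentiable (smooth_on_partial l sG) Ux.
rewrite -[wedge _ _ _ _]/(partial F i * partial G j - partial F j * partial G i).
by apply: differentiableB; exact: differentiableM.
Qed.

Lemma partial_rot_bivector U k F G (x : 'rV[R]_3) :
  smooth_on U F -> smooth_on U G -> U x ->
  partial (rot_bivector F G) k x =
    (x 0 0 * partial (wedge 1 2 F G) k x + wedge 1 2 F G x * (k == 0)%:R)
    + (x 0 1 * partial (wedge 2 0 F G) k x + wedge 2 0 F G x * (k == 1)%:R)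
    + (x 0 2 * partial (wedge 0 1 F G) k x + wedge 0 1 F G x * (k == 2)%:R).
Proof.
move=> sF sG Ux.
have dw i j := smooth_on_differentiable_wedge i j sF sG Ux.
pose X i : 'rV[R]_3 -> R := fun y => y 0 i.
have dX i : differentiable (X i) x by exact: differentiable_coord.
have dXw i j l : differentiable (X l * wedge i j F G) x by exact: differentiableM.
rewrite -[rot_bivector F G]/(X 0 * wedge 1 2 F G + X 1 * wedge 2 0 F G
  + X 2 * wedge 0 1 F G).
have leaf l W : differentiable W x ->
    partial (X l * W) k x = x 0 l * partial W k x + W x * (k == l)%:R.
  by move=> dW; rewrite (partialM k (dX l) dW) /X partial_coord.
apply: etrans (partialD k (differentiableD (dXw 1 2 0) (dXw 2 0 1)) (dXw 0 1 2)) _.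
apply: (congr2 +%R _ (leaf 2 _ (dw 0 1))).
apply: etrans (partialD k (dXw 1 2 0) (dXw 2 0 1)) _.
exact: (congr2 +%R (leaf 0 _ (dw 1 2)) (leaf 1 _ (dw 2 0))).
Qed.

(** The determinant of [x], [a], [b]. With bare triples of numbers in place of gradients, the
    identities of the bracket become polynomial identities. *)
Definition triple (x a b : 'I_3 -> R) : R :=
  x 0 * (a 1 * b 2 - a 2 * b 1) + x 1 * (a 2 * b 0 - a 0 * b 2)
  + x 2 * (a 0 * b 1 - a 1 * b 0).

Lemma rot_bivector_triple F G (x : 'rV[R]_3) : rot_bivector F G x =
  triple (fun i => x 0 i) (fun i => partial F i x) (fun i => partial G i x).
Proof. by []. Qed.

(* The gradient of [triple x a b] for a and b with derivatives a' and b'. *)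
Definition dtriple (x a b : 'I_3 -> R) (a' b' : 'I_3 -> 'I_3 -> R) (k : 'I_3) : R :=
  let dw i j := (a i * b' j k + b j * a' i k) - (a j * b' i k + b i * a' j k) in
  (x 0 * dw 1 2 + (a 1 * b 2 - a 2 * b 1) * (k == 0)%:R)
  + (x 1 * dw 2 0 + (a 2 * b 0 - a 0 * b 2) * (k == 1)%:R)
  + (x 2 * dw 0 1 + (a 0 * b 1 - a 1 * b 0) * (k == 2)%:R).

Lemma partial_rot_bivector_triple U k F G (x : 'rV[R]_3) :
  smooth_on U F -> smooth_on U G -> U x ->
  partial (rot_bivector F G) k x =
    dtriple (fun i => x 0 i) (fun i => partial F i x) (fun i => partial G i x)
      (fun i j => partial (partial F i) j x) (fun i j => partial (partial G i) j x) k.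
Proof.
move=> sF sG Ux; apply: etrans (partial_rot_bivector k sF sG Ux) _.
have pw i j l y := congr1 (fun z => x 0 l * z + y) (partial_wedge i j k sF sG Ux).
exact: (congr2 +%R (congr2 +%R (pw 1 2 0 _) (pw 2 0 1 _)) (pw 0 1 2 _)).
Qed.

(** Here [a'], [b'], [c'] stand for Hessians. Their symmetry cancels the second-order terms; the
    remaining terms cancel by the Jacobi identity of the cross product. *)
Lemma triple_jacobi (x a b c : 'I_3 -> R) (a' b' c' : 'I_3 -> 'I_3 -> R) :
  (forall i j, a' i j = a' j i) -> (forall i j, b' i j = b' j i) ->
  (forall i j, c' i j = c' j i) ->
  triple x (dtriple x a b a' b') c + triple x (dtriple x b c b' c') a
  + triple x (dtriple x c a c' a') b = 0.
Proof.
move=> sa sb sc; rewrite /triple /dtriple /=.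
(* Only upper triangular entries are kept, so that [ring] sees each symmetric pair as one
   variable. *)
rewrite (sa 1 0) (sa 2 0) (sa 2 1) (sb 1 0) (sb 2 0) (sb 2 1).
rewrite (sc 1 0) (sc 2 0) (sc 2 1).
move: (a' 0 0) (a' 0 1) (a' 0 2) (a' 1 1) (a' 1 2) (a' 2 2).
move: (b' 0 0) (b' 0 1) (b' 0 2) (b' 1 1) (b' 1 2) (b' 2 2).
move: (c' 0 0) (c' 0 1) (c' 0 2) (c' 1 1) (c' 1 2) (c' 2 2).
move: (a 0) (a 1) (a 2) (b 0) (b 1) (b 2) (c 0) (c 1) (c 2) (x 0) (x 1) (x 2).
clear; move=> *; ring.
Qed.

(** For fixed [x], [triple x] is an alternating 2-form on a three-dimensional space, and the
    left-hand side is, up to a factor, its wedge square: a 4-form, hence zero. *)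
Lemma triple_plucker (x a b c d : 'I_3 -> R) :
  triple x a b * triple x c d + triple x b c * triple x a d
  + triple x c a * triple x b d = 0.
Proof. by rewrite /triple; ring. Qed.

Lemma eq_triple (x a a' b b' : 'I_3 -> R) :
  a =1 a' -> b =1 b' -> triple x a b = triple x a' b'.
Proof. by move=> aa' bb'; rewrite /triple !aa' !bb'. Qed.

(** Jacobi identity of the Lie-Poisson bracket of so(3), proved on open subsets of R^3, where
    [partialC] supplies the symmetric Hessians. *)
Lemma rot_bivector_jacobi U F G H (x : 'rV[R]_3) : open U ->
  smooth_on U F -> smooth_on U G -> smooth_on U H -> U x ->
  rot_bivector (rot_bivector F G) H x + rot_bivector (rot_bivector G H) F x
  + rot_bivector (rot_bivector H F) G x = 0.
Proof.
move=> oU sF sG sH Ux; rewrite !rot_bivector_triple.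
have E A B C : smooth_on U A -> smooth_on U B ->
    triple (fun i => x 0 i) (fun i => partial (rot_bivector A B) i x)
      (fun i => partial C i x) =
    triple (fun i => x 0 i) (dtriple (fun i => x 0 i)
      (fun i => partial A i x) (fun i => partial B i x)
      (fun i j => partial (partial A i) j x)
      (fun i j => partial (partial B i) j x)) (fun i => partial C i x).
  move=> sA sB; apply: eq_triple => // k.
  exact: partial_rot_bivector_triple sA sB Ux.
apply: etrans (congr2 +%R (congr2 +%R (E _ _ H sF sG) (E _ _ F sG sH))
  (E _ _ G sH sF)) _.
by apply: triple_jacobi => i j; [exact: partialC oU sF Ux
  |exact: partialC oU sG Ux|exact: partialC oU sH Ux].
Qed.
End Bracket.

(** * The Schouten bracket in low degree *)

Section LowDegreeSchouten.
Variables (R : comNzRingType) (A : comAlgType R).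
Implicit Types (B C : A -> A -> A) (D : A -> A).

Lemma permuted_ord n (f : 'I_n -> A) (s : 'S_n) (i : 'I_n) :
  permuted f s i = f (s i).
Proof. by rewrite /permuted valK. Qed.

Lemma ord2P (i : 'I_2) : i = 0 \/ i = 1.
Proof. by case: i => -[|[|//]] ?; [left|right]; exact: val_inj. Qed.

Lemma ord3P (i : 'I_3) : [\/ i = 0, i = 1 | i = 2].
Proof.
by case: i => -[|[|[|//]]] ?; [constructor 1|constructor 2|constructor 3];
  exact: val_inj.
Qed.

Lemma sum_S2 (F : 'S_2 -> A) : \sum_s F s = F 1%g + F (tperm 0 1).
Proof.
rewrite (bigD1 1%g)//= (big_pred1 (tperm 0 1))// => s; apply/idP/eqP => [s1|->].
  have s0 : s 0 = 1.
    case: (ord2P (s 0)) => // s0; case/eqP: s1; apply/permP => i; rewrite perm1.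
    case: (ord2P i) => -> //; case: (ord2P (s 1)) => // s1.
    by have := @perm_inj _ s 0 1; rewrite s0 s1 => /(_ erefl).
  have s1' : s 1 = 0.
    case: (ord2P (s 1)) => // s1'.
    by have := @perm_inj _ s 0 1; rewrite s0 s1' => /(_ erefl).
  by apply/permP => i; case: (ord2P i) => ->; rewrite ?tpermL ?tpermR.
by apply/eqP => /permP /(_ 0); rewrite tpermL perm1.
Qed.

Lemma shuffle11 (s : 'S_2) : shuffle 1 s.
Proof.
apply/forallP => i; apply/forallP => j.
by case: (ord2P i) => ->; case: (ord2P j) => ->.
Qed.

Lemma shuffle20 (s : 'S_2) : shuffle 2 s = (s == 1%g).
Proof.
apply/idP/eqP => [/forallP/(_ 0)/forallP/(_ 1)/= s01|->]; last first.
  by apply/forallP => i; apply/forallP => j; rewrite !perm1;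
    case: (ord2P i) => ->; case: (ord2P j) => ->.
apply/permP => i; rewrite perm1.
by move: s01; case: (ord2P i) => ->; case: (ord2P (s 0)) => ->;
   case: (ord2P (s 1)) => ->.
Qed.

(** Both permutations of two indices are (1,1)-shuffles, and the transposition contributes the minus
    sign. Curried [B] and [D] keep functions on ordinals out of later computations. *)
Lemma insertion21 B D (f : 'I_2 -> A) :
  insertion (fun f : 'I_2 -> A => B (f 0) (f 1)) (fun f : 'I_1 -> A => D (f 0)) f
  = B (D (f 0)) (f 1) - B (D (f 1)) (f 0).
Proof.
rewrite /insertion /= (eq_bigl xpredT) => [|s]; last exact: shuffle11.
rewrite sum_S2 odd_perm1 odd_tperm /= expr0 mul1r expr1 mulN1r.
rewrite ![permuted _ _ 0](permuted_ord _ _ (0 : 'I_2)).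
rewrite ![permuted _ _ (1 + 0)](permuted_ord _ _ (1 : 'I_2)).
by rewrite !perm1 tpermL tpermR.
Qed.

Lemma insertion12 D B (f : 'I_2 -> A) :
  insertion (fun f : 'I_1 -> A => D (f 0)) (fun f : 'I_2 -> A => B (f 0) (f 1)) f
  = D (B (f 0) (f 1)).
Proof.
rewrite /insertion /= (eq_bigl _ _ shuffle20) big_pred1_eq.
rewrite odd_perm1 expr0 mul1r.
rewrite ![permuted _ _ 0](permuted_ord _ _ (0 : 'I_2)).
rewrite ![permuted _ _ 1](permuted_ord _ _ (1 : 'I_2)).
by rewrite !perm1.
Qed.

Lemma shuffle21 (s : 'S_3) : shuffle 2 s = (s 0%R < s 1%R)%N.
Proof.
apply/idP/idP => [/forallP/(_ 0)/forallP/(_ 1)//|s01].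
by apply/forallP => i; apply/forallP => j;
  case: (ord3P i) => ->; case: (ord3P j) => ->.
Qed.

Lemma perm3P (s t : 'S_3) : s 0 = t 0 -> s 1 = t 1 -> s 2 = t 2 -> s = t.
Proof. by move=> s0 s1 s2; apply/permP => i; case: (ord3P i) => ->. Qed.

Lemma sum_I3 (F : 'I_3 -> A) : \sum_i F i = F 0 + F 1 + F 2.
Proof.
rewrite 3!big_ord_recl big_ord0 addr0 addrA.
by congr (F _ + F _ + F _); exact: val_inj.
Qed.

(** Permutations compose from left to right here: [tperm 0 1] acts first. This cycle is the even
    shuffle that brings index 0 to the last place. *)
Lemma cycle3E : let t : 'S_3 := (tperm 0%R 1%R * tperm 0%R 2%R)%g in
  [/\ t 0 = 1, t 1 = 2 & t 2 = 0].
Proof.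
split; rewrite permM.
- by rewrite tpermL tpermD.
- by rewrite tpermR tpermL.
- by rewrite [tperm 0 1 2]tpermD// tpermR.
Qed.

(** A (2,1)-shuffle is determined by its value at 2, since the two other values must be increasing.
    The sum is split along that value. *)
Lemma sum_shuffle21 (F : 'S_3 -> A) :
  \sum_(s : 'S_3 | shuffle 2 s) F s =
  F 1%g + F (tperm 1 2) + F (tperm 0%R 1%R * tperm 0%R 2%R)%g.
Proof.
rewrite (eq_bigl _ _ shuffle21) (partition_big (fun s : 'S_3 => s 2) xpredT)//=.
rewrite sum_I3.
have E k (t : 'S_3) : t 2 = k -> (t 0%R < t 1%R)%N ->
    (fun s : 'S_3 => (s 0%R < s 1%R)%N && (s 2 == k)) =1 pred1 t.
  move=> tk t01 s; apply/andP/eqP => [[s01 /eqP sk]|->]; last by rewrite tk eqxx.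
  have inj (u : 'S_3) : [/\ u 0 != u 1, u 0 != u 2 & u 1 != u 2].
    by rewrite !(inj_eq perm_inj).
  have [st0 st1] : s 0 = t 0 /\ s 1 = t 1.
    have [_ + +] := inj s; have [_ + +] := inj t; rewrite sk tk.
    move: s01 t01.
    by case: (ord3P (s 0)) => ->; case: (ord3P (s 1)) => ->;
      case: (ord3P (t 0)) => ->; case: (ord3P (t 1)) => ->; case: (ord3P k) => ->.
  by apply: perm3P => //; rewrite sk tk.
rewrite (big_pred1 (tperm 0%R 1%R * tperm 0%R 2%R)%g); last first.
  by have [p0 p1 p2] := cycle3E; apply: E; rewrite ?p0 ?p1.
rewrite (big_pred1 (tperm 1 2)); last by apply: E; rewrite ?tpermR ?tpermL ?tpermD.
rewrite (big_pred1 1%g); last by apply: E; rewrite ?perm1.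
by rewrite addrC (addrC (F (_ * _)%g)) addrA.
Qed.

Lemma insertion22 B C (f : 'I_3 -> A) :
  insertion (fun f : 'I_2 -> A => B (f 0) (f 1))
    (fun f : 'I_2 -> A => C (f 0) (f 1)) f
  = B (C (f 0) (f 1)) (f 2) - B (C (f 0) (f 2)) (f 1) + B (C (f 1) (f 2)) (f 0).
Proof.
rewrite /insertion /= sum_shuffle21 odd_permM !odd_tperm odd_perm1 /=.
rewrite expr0 expr1 mul1r mulN1r.
rewrite ![permuted _ _ 0](permuted_ord _ _ (0 : 'I_3)).
rewrite ![permuted _ _ 1](permuted_ord _ _ (1 : 'I_3)).
rewrite ![permuted _ _ (2 + 0)](permuted_ord _ _ (2 : 'I_3)).
have [-> -> ->] := cycle3E; rewrite !perm1 tpermL tpermR tpermD//.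
by rewrite mul1r.
Qed.

(** The sign exponent 3 * 2 is even. For alternating [B] this is minus the Lie derivative of [B]
    along [D], the defect of [D] as a derivation of the bracket. *)
Lemma dpi1 B D (f : 'I_2 -> A) :
  dpi (fun f : 'I_2 -> A => B (f 0) (f 1)) (fun f : 'I_1 -> A => D (f 0)) f
  = B (D (f 0)) (f 1) - B (D (f 1)) (f 0) - D (B (f 0) (f 1)).
Proof.
rewrite /dpi /schouten !fctE /mulmv insertion21 insertion12.
by rewrite -signr_odd /= expr0 mul1r.
Qed.

(** The exponent 3 * 3 is odd, so the two insertions add up: this is the Jacobiator polarized in [B]
    and [C]. *)
Lemma dpi2 B C (f : 'I_3 -> A) :
  dpi (fun f : 'I_2 -> A => B (f 0) (f 1)) (fun f : 'I_2 -> A => C (f 0) (f 1)) f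
  = B (C (f 0) (f 1)) (f 2) - B (C (f 0) (f 2)) (f 1) + B (C (f 1) (f 2)) (f 0)
    + (C (B (f 0) (f 1)) (f 2) - C (B (f 0) (f 2)) (f 1) + C (B (f 1) (f 2)) (f 0)).
Proof.
rewrite /dpi /schouten !fctE /mulmv !insertion22.
by rewrite -signr_odd /= expr1 mulN1r opprK.
Qed.

End LowDegreeSchouten.

(** * The bracket on the sphere *)

Section CinfBracket.
Variable R : realType.
Implicit Types (f g h u : Cinf R) (p : sphere R) (F G H : 'rV[R]_3 -> R).

Lemma pi_bracket_val f g p F G :
  extends_near (val f) p F -> extends_near (val g) p G ->
  val (pi_bracket f g) p = - rot_bivector F G (val p).
Proof. by move=> eF eG; rewrite -(pi_bracketE eF eG) opprK. Qed.

(** An explicit local extension of a bracket is what makes iterated brackets computable in R^3. *)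
Lemma extends_near_pi_bracket f g p F G :
  extends_near (val f) p F -> extends_near (val g) p G ->
  extends_near (val (pi_bracket f g)) p (cst (- 1) * rot_bivector F G).
Proof.
move=> [U [oU Up sF eF]] [V [oV Vp sG eG]]; exists (U `&` V).
have oUV := openI oU oV.
split=> // [n|q [Uq Vq]].
  apply: CnM => //; first exact: Cn_cst.
  apply: smooth_rot_bivector => // k.
    by apply: sub_Cn (sF k) => x [].
  by apply: sub_Cn (sG k) => x [].
rewrite (@pi_bracket_val f g q F G); first by rewrite fctE mulN1r.
  by exists U.
by exists V.
Qed.

Lemma pi_bracketC f g : pi_bracket f g = - pi_bracket g f.
Proof.
apply/val_inj/funext => p.
have [eF eG] := (extensionP f p, extensionP g p).
rewrite (pi_bracket_val eF eG) rot_bivectorC opprK /=.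
by rewrite -[LHS]opprK.
Qed.

Lemma extends_near_differentiable (f : sphere R -> R) p F :
  extends_near f p F -> differentiable F (val p).
Proof. by move=> [U [_ Up sF _]]; exact: smooth_differentiable sF Up. Qed.

Lemma tripleDl (x a b c : 'I_3 -> R) (s t : R) :
  triple x (fun i => s * a i + t * b i) c = s * triple x a c + t * triple x b c.
Proof. by rewrite /triple; ring. Qed.

(** Only the gradient of the first extension at [p] matters. It can thus be replaced by the outcome
    of a sum or product rule, after which [tripleDl] applies. *)
Lemma pi_bracket_grad f g p F G (a : 'I_3 -> R) :
  extends_near (val f) p F -> extends_near (val g) p G ->
  (forall i, partial F i (val p) = a i) ->
  val (pi_bracket f g) p =
    - triple (fun i => val p 0 i) a (fun i => partial G i (val p)).
Proof.
move=> eF eG Fa; rewrite (pi_bracket_val eF eG) rot_bivector_triple.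
by congr (- _); exact: eq_triple.
Qed.

Lemma pi_bracket_linear f (r : R) g h :
  pi_bracket (r *: g + h) f = r *: pi_bracket g f + pi_bracket h f.
Proof.
apply/val_inj/funext => p.
have [eF eG eH] := And3 (extensionP f p) (extensionP g p) (extensionP h p).
have eK := extends_nearD (extends_nearM (extends_near_cst r p) eG) eH.
have dG := extends_near_differentiable eG.
have dH := extends_near_differentiable eH.
have dc : differentiable (cst r : 'rV[R]_3 -> R) (val p) by exact: differentiable_cst.
apply: etrans (@pi_bracket_grad (r *: g + h) f p _ _
  (fun i => r * partial (extension g p) i (val p)
    + 1 * partial (extension h p) i (val p)) eK eF _) _.
  move=> i; apply: etrans (partialD i (differentiableM dc dG) dH) _.
  by rewrite (partialM i dc dG) partial_cst mulr0 addr0 mul1r.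
rewrite tripleDl mul1r opprD -mulrN.
exact/esym/(congr2 (fun y z => r * y + z) (pi_bracket_val eG eF) (pi_bracket_val eH eF)).
Qed.

Lemma pi_bracketM f g h :
  pi_bracket (g * h) f = g * pi_bracket h f + h * pi_bracket g f.
Proof.
apply/val_inj/funext => p.
have [eF eG eH] := And3 (extensionP f p) (extensionP g p) (extensionP h p).
have eK := extends_nearM eG eH.
have dG := extends_near_differentiable eG.
have dH := extends_near_differentiable eH.
apply: etrans (@pi_bracket_grad (g * h) f p _ _
  (fun i => val g p * partial (extension h p) i (val p)
    + val h p * partial (extension g p) i (val p)) eK eF _) _.
  move=> i; apply: etrans (partialM i dG dH) _.
  (* The product rule yields values of the extensions at [p]; they agree with the functions because
     [p] lies in the neighbourhoods of extension. *)
  have ev u : val u p = extension u p (val p).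
    by case: (extensionP u p) => U [_ Up _ ->].
  by rewrite !ev.
rewrite tripleDl opprD -!mulrN.
exact/esym/(congr2 (fun y z => val g p * y + val h p * z)
  (pi_bracket_val eH eF) (pi_bracket_val eG eF)).
Qed.

Lemma pi_bracket_plucker f g h u :
  pi_bracket f g * pi_bracket h u + pi_bracket g h * pi_bracket f u
  + pi_bracket h f * pi_bracket g u = 0.
Proof.
apply/val_inj/funext => p; apply: etrans (triple_plucker (fun i => val p 0 i)
  (fun i => partial (extension f p) i (val p))
  (fun i => partial (extension g p) i (val p))
  (fun i => partial (extension h p) i (val p))
  (fun i => partial (extension u p) i (val p))).
exact: (congr2 +%R (congr2 +%R (mulrNN _ _) (mulrNN _ _)) (mulrNN _ _)).
Qed.

Lemma pi_bracket_jacobi f g h :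
  pi_bracket (pi_bracket f g) h + pi_bracket (pi_bracket g h) f
  + pi_bracket (pi_bracket h f) g = 0.
Proof.
apply/val_inj/funext => p.
have [eF eG eH] := And3 (extensionP f p) (extensionP g p) (extensionP h p).
have [U [oU Up [sF sG sH]]] : exists U : set 'rV[R]_3, [/\ open U, U (val p) &
    [/\ smooth_on U (extension f p), smooth_on U (extension g p)
       & smooth_on U (extension h p)]].
  have [[U [oU Up sF _]] [V [oV Vp sG _]] [W [oW Wp sH _]]] := And3 eF eG eH.
  exists (U `&` V `&` W); split=> //; first exact: openI (openI oU oV) oW.
  by split=> n; [apply: sub_Cn (sF n)|apply: sub_Cn (sG n)|apply: sub_Cn (sH n)] =>
    x [[]].
(* [pi_bracket] restricts [- rot_bivector], and the two signs of a nested bracket cancel. The zero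
   summand in the gradient below only gives it the shape expected by [tripleDl]. *)
have E (f1 f2 f3 : Cinf R) F1 F2 F3 : extends_near (val f1) p F1 ->
    extends_near (val f2) p F2 -> extends_near (val f3) p F3 ->
    smooth_on U F1 -> smooth_on U F2 ->
    val (pi_bracket (pi_bracket f1 f2) f3) p =
    rot_bivector (rot_bivector F1 F2) F3 (val p).
  move=> e1 e2 e3 s1 s2.
  have dr : differentiable (rot_bivector F1 F2) (val p).
    exact: smooth_differentiable (smooth_rot_bivector oU s1 s2) Up.
  have dc : differentiable (cst (- 1) : 'rV[R]_3 -> R) (val p) by exact: differentiable_cst.
  apply: etrans (@pi_bracket_grad (pi_bracket f1 f2) f3 p _ _
    (fun i => - 1 * partial (rot_bivector F1 F2) i (val p)
       + 0 * partial (rot_bivector F1 F2) i (val p))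
    (extends_near_pi_bracket e1 e2) e3 _) _.
    move=> i; apply: etrans (partialM i dc dr) _.
    by rewrite partial_cst mulr0 mul0r.
  by rewrite tripleDl mul0r addr0 mulN1r opprK.
apply: etrans (rot_bivector_jacobi oU sF sG sH Up).
exact: (congr2 +%R (congr2 +%R (E _ _ _ _ _ _ eF eG eH sF sG)
  (E _ _ _ _ _ _ eG eH eF sG sH)) (E _ _ _ _ _ _ eH eF eG sH sF)).
Qed.

Lemma pi_bracket0 f : pi_bracket 0 f = 0.
Proof. by have := pi_bracket_linear f (-1) 0 0; rewrite scaler0 addr0 scaleN1r addNr. Qed.

Lemma sphere_pi_multivector (r : R) :
  multivector_fields (Cinf R) 2 (r *: @sphere_pi R).
Proof.
have pE (f : 'I_2 -> Cinf R) : (r *: @sphere_pi R) f = r *: pi_bracket (f 0) (f 1) by [].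
have lr (f g h : Cinf R) s : pi_bracket f (s *: g + h) = s *: pi_bracket f g + pi_bracket f h.
  by rewrite !(pi_bracketC f) pi_bracket_linear opprD scalerN.
have lM (f g h : Cinf R) : pi_bracket f (g * h) = g * pi_bracket f h + h * pi_bracket f g.
  by rewrite !(pi_bracketC f) pi_bracketM opprD !mulrN.
split.
- move=> f i s a b; rewrite !pE /update; case: (ord2P i) => -> /=.
    by rewrite pi_bracket_linear scalerDr !scalerA mulrC.
  by rewrite lr scalerDr !scalerA mulrC.
- have pi_self (g : Cinf R) : pi_bracket g g = 0.
    have : 2%:R *: pi_bracket g g = 0.
      by rewrite scaler_nat mulr2n {1}pi_bracketC addNr.
    move/eqP; rewrite scaler_eq0 => /orP[|/eqP//].
    by rewrite pnatr_eq0.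
  move=> f i j ij fij; rewrite pE.
  have -> : f 1 = f 0.
    by move: ij fij; case: (ord2P i) => ->; case: (ord2P j) => ->.
  by rewrite pi_self scaler0.
- move=> f i a b; rewrite !pE /update; case: (ord2P i) => -> /=.
    by rewrite pi_bracketM scalerDr -!scalerAr.
  by rewrite lM scalerDr -!scalerAr.
Qed.

Lemma sphere_pi_cocycle (c r : R) : cocycles (necklace c) 2 (r *: @sphere_pi R).
Proof.
split; first exact: sphere_pi_multivector.
apply/funext => f; set x := c%:A - Defs.coord R 2.
have brZ a g h : pi_bracket (a *: g) h = a *: pi_bracket g h.
  by rewrite -[a *: g]addr0 pi_bracket_linear pi_bracket0 addr0.
apply: etrans (dpi2 (fun g h => x * pi_bracket g h)
  (fun g h => r *: pi_bracket g h) f) _.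
rewrite !brZ !pi_bracketM.
have J := pi_bracket_jacobi (f 0) (f 1) (f 2).
have P := pi_bracket_plucker (f 0) (f 1) (f 2) x.
have brN g h : pi_bracket (- g) h = - pi_bracket g h.
  by rewrite -scaleN1r brZ scaleN1r.
rewrite (pi_bracketC (f 2) (f 0)) brN in J.
rewrite (pi_bracketC (f 2) (f 0)) in P.
rewrite !(pi_bracketC x).
rewrite -!scalerAr.
move: J P; move: (pi_bracket (pi_bracket (f 0) (f 1)) (f 2))
  (pi_bracket (pi_bracket (f 1) (f 2)) (f 0))
  (pi_bracket (pi_bracket (f 0) (f 2)) (f 1)) => j1 j2 j3.
move: (pi_bracket (f 0) (f 1)) (pi_bracket (f 1) (f 2)) (pi_bracket (f 0) (f 2))
  (pi_bracket (f 0) x) (pi_bracket (f 1) x) (pi_bracket (f 2) x).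
move=> p01 p12 p02 q0 q1 q2 J P; rewrite -!(scalerBr, scalerDr).
set z := (X in r *: X).
(* Both halves of [dpi2] contain [x] times the Jacobiator. The terms in which [x] itself is
   bracketed form the Pluecker relation with fourth entry [x]. *)
have -> : z = x * (j1 + j2 - j3) + x * (j1 + j2 - j3)
    - (p01 * q2 + p12 * q0 + - p02 * q1).
  by rewrite /z; move: x j1 j2 j3 p01 p12 p02 q0 q1 q2 {J P z}; clear => *; ring.
by rewrite J P mulr0 subr0 addr0 scaler0.
Qed.

End CinfBracket.

(** * Averages over the circle *)

Section MeanOverCircle.
Variable R : realType.
Local Notation mu := (@lebesgue_measure R).
(** Here [pi] is the number, not the bivector. The integral is not divided by the length of the
    period, so a constant [a] has mean [a * (pi *+ 2)]. *)
Local Notation mean U t := (\int[mu]_(th in `[0%R, (pi *+ 2)%R]) U t th)%R.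
Implicit Types U V : R -> R -> R.

Definition continuous2 U := continuous (fun z : R * R => U z.1 z.2).

Lemma continuous2_section U t : continuous2 U -> continuous (U t).
Proof.
move=> cU th; rewrite /continuous_at.
have H := @continuous2_cvg R R R R (nbhs th) _ (fun=> t) (fun s => s) U t th
  (cU (t, th)) (cvg_cst t) (@cvg_id _ _).
exact: H.
Qed.

Lemma continuous_integrable_itv (f : R -> R) a b : continuous f ->
  mu.-integrable `[a, b] (EFin \o f).
Proof.
move=> cf; apply: continuous_compact_integrable; first exact: segment_compact.
exact: continuous_subspaceT.
Qed.

Lemma continuous2_bounded U a b a' b' : continuous2 U -> exists M : R,
  forall s t, s \in `[a, b] -> t \in `[a', b'] -> `|U s t| <= M.
Proof.
move=> cU; have cpt : compact (`[a, b] `*` `[a', b'])%classic.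
  by apply: compact_setX; exact: segment_compact.
have := compact_bounded (continuous_compact
  (continuous_subspaceT cU (A := (`[a, b] `*` `[a', b'])%classic)) cpt).
move=> [M [_ hM]]; exists (M + 1) => s t sab tab.
by apply: (hM (M + 1)); [rewrite ltrDl|exists (s, t)].
Qed.

(** Differentiation under the integral sign: the dominating constant is a bound of [U'] on the
    compact rectangle of times within 1 of [t]. *)
Lemma is_derive_mean U U' (t : R) : continuous2 U -> continuous2 U' ->
  (forall s th : R, is_derive s 1 (U ^~ th) (U' s th)) ->
  is_derive t 1 (fun s => mean U s) (mean U' t).
Proof.
move=> cU cU' dU.
have [M hM] := continuous2_bounded (t - 1) (t + 1) 0 (pi *+ 2) cU'.
have tI : `]t - 1, t + 1[%classic t by rewrite /= in_itv/= ltrBlDr !ltrDl ltr01.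
have pE (s th : R) : partial1of2 U s th = U' s th.
  by rewrite partial1of2E; have [_ ->] := dU s th.
have intU (s : R) : `]t - 1, t + 1[%classic s -> mu.-integrable `[0%R, (pi *+ 2)%R] (EFin \o U s).
  by move=> _; apply: continuous_integrable_itv; exact: continuous2_section.
have dU1 (s th : R) : `]t - 1, t + 1[%classic s -> `[0%R, (pi *+ 2)%R]%classic th ->
    derivable (U ^~ th) s 1 by move=> _ _; have [] := dU s th.
have intM : mu.-integrable `[0%R, (pi *+ 2)%R] (EFin \o cst `|M|).
  by apply: continuous_integrable_itv; exact: cst_continuous.
have M0 (th : R) : 0 <= cst `|M| th :> R by exact: normr_ge0.
have bM (s th : R) : `]t - 1, t + 1[%classic s -> `[0%R, (pi *+ 2)%R]%classic th ->
    `|partial1of2 U s th| <= cst `|M| th.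
  move=> sI thI; rewrite pE; apply: le_trans (ler_norm M); apply: hM => //.
  exact: subset_itv_oo_cc.
have mD : measurable (`[0%R, (pi *+ 2)%R]%classic : set (measurableTypeR R)).
  exact: measurable_itv.
apply: DeriveDef; first exact: (derivable_under_integral mD tI intU dU1 M0 intM bM).
rewrite -derive1E (differentiation_under_integral mD tI intU dU1 M0 intM bM).
by apply: eq_Rintegral => th _; rewrite pE.
Qed.

(** The fundamental theorem of calculus over a full period; this removes the longitudinal part of
    the divergence. *)
Lemma mean_derive V V' (t : R) : continuous2 V' ->
  (forall th : R, is_derive th 1 (V t) (V' t th)) -> V t (pi *+ 2) = V t 0 ->
  mean V' t = 0.
Proof.
move=> cV' dV per.
have pi2 : 0 < pi *+ 2 :> R by rewrite mulrn_wgt0// pi_gt0.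
have cV : continuous (V t).
  move=> th; apply/differentiable_continuous/derivable1_diffP.
  by have [] := dV th.
rewrite /Rintegral (@continuous_FTC2 R (V' t) (V t) 0 (pi *+ 2) pi2).
- by rewrite per subee.
- by apply: continuous_subspaceT; exact: continuous2_section.
- split; first by move=> th _; have [] := dV th.
    by apply: cvg_at_right_filter; exact: cV.
  by apply: cvg_at_left_filter; exact: cV.
- by move=> th _; rewrite derive1E; have [_ ->] := dV th.
Qed.

(** The coefficients depend on [t] alone and so leave the integral over [th], while [V'] integrates
    to zero. *)
Lemma mean_ode U U' V V' (g h : R -> R) (a : R) :
  continuous2 U -> continuous2 U' -> continuous2 V' ->
  (forall t th : R, is_derive t 1 (U ^~ th) (U' t th)) ->
  (forall t th : R, is_derive th 1 (V t) (V' t th)) ->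
  (forall t, V t (pi *+ 2) = V t 0) ->
  (forall t th, g t * (U' t th - V' t th) = h t * (U t th - a)) ->
  forall t, g t * mean U' t = h t * (mean U t - a * (pi *+ 2)).
Proof.
move=> cU cU' cV' dU dV per E t.
have mD : measurable (`[0%R, (pi *+ 2)%R]%classic : set (measurableTypeR R)) by exact: measurable_itv.
have int W : continuous2 W -> mu.-integrable `[0%R, (pi *+ 2)%R] (EFin \o W t).
  by move=> cW; apply: continuous_integrable_itv; exact: continuous2_section.
have inta : mu.-integrable `[0%R, (pi *+ 2)%R] (EFin \o cst a).
  by apply: continuous_integrable_itv; exact: cst_continuous.
have intB1 : mu.-integrable `[0%R, (pi *+ 2)%R] (EFin \o (fun th => U' t th - V' t th)).
  apply: continuous_integrable_itv => th.
  by apply: cvgB; exact: continuous2_section.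
have intB2 : mu.-integrable `[0%R, (pi *+ 2)%R] (EFin \o (fun th => U t th - a)).
  apply: continuous_integrable_itv => th.
  by apply: cvgB; [exact: continuous2_section|exact: cvg_cst].
have -> : mean U' t = mean U' t - mean V' t.
  by rewrite (mean_derive cV' (dV t) (per t)) subr0.
rewrite -(RintegralB mD (int _ cU') (int _ cV')) -(RintegralZl (g t) mD intB1).
have -> : a * (pi *+ 2) = \int[mu]_(th in `[0%R, (pi *+ 2)%R]) (cst a th).
  rewrite Rintegral_cst//= lebesgue_measure_itv/= lte_fin mulrn_wgt0 ?pi_gt0//.
  by rewrite oppr0 adde0.
rewrite -(RintegralB mD (int _ cU) inta) -(RintegralZl (h t) mD intB2).
by apply: eq_Rintegral => th _; exact: E.
Qed.

End MeanOverCircle.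

(** * Spherical coordinates *)

Section SphericalCoordinates.
Variable R : realType.
Implicit Types (f g : Cinf R) (p : sphere R).

Lemma extends_near_coord (j : 'I_3) p :
  extends_near (val (Defs.coord R j)) p (fun x => x 0 j).
Proof. by exists setT; split=> // [|n]; [exact: openT|exact: Cn_coord]. Qed.

Lemma pi_bracket_coord f (j : 'I_3) p :
  let a i := partial (extension f p) i (val p) in
  val (pi_bracket f (Defs.coord R j)) p =
    - triple (fun i => val p 0 i) a (fun i => (i == j)%:R).
Proof.
move=> a; rewrite (pi_bracket_val (extensionP f p) (extends_near_coord j p)).
rewrite rot_bivector_triple; congr (- _); apply: eq_triple => // i.
exact: partial_coord.
Qed.

(** The chain rule in R^3. The extension is only local, but by continuity the curve stays in its
    domain near [s]. *)
Lemma is_derive_curve f (q : R -> sphere R) (s : R) (w : 'I_3 -> R) :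
  (forall i, is_derive s 1 (fun r => val (q r) 0 i) (w i)) ->
  is_derive s 1 (fun r => val f (q r))
    (\sum_i w i * partial (extension f (q s)) i (val (q s))).
Proof.
move=> dq; pose c r : 'rV[R]_3 := val (q r).
have dc : derivable c s 1.
  by apply/derivable_mxP => i j; rewrite ord1; have [] := dq j.
have vc : 'D_1 c s = \row_i w i.
  rewrite derive_mx//; apply/rowP => i; rewrite !mxE.
  by have [_ <-] := dq i.
have diffc : differentiable c s by exact/derivable1_diffP.
have [U [oU Us sF eF]] := extensionP f (q s); set F := extension f (q s) in sF eF *.
have dF : differentiable F (c s) by exact: smooth_differentiable sF Us.
have dFc : differentiable (F \o c) s by exact: differentiable_comp.
have -> : \sum_i w i * partial F i (val (q s)) = 'D_1 (F \o c) s.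
  rewrite deriveE// diff_comp//= -(deriveE _ diffc) vc (row_sum_delta (\row_i w i)) linear_sum /=.
  by apply: eq_bigr => i _; rewrite linearZ /= mxE /partial deriveE.
apply: (@near_eq_is_derive _ _ _ (F \o c)); last first.
  by apply: DeriveDef => //; exact/derivable1_diffP.
have nU : \forall r \near s, U (c r).
  by apply: (differentiable_continuous diffc); exact: open_nbhs_nbhs.
by apply: filterS nU => r Ur /=; rewrite eF.
Qed.

(** Colatitude [t] and longitude [th] range over all reals, so functions of [t] are differentiable
    across the poles [t = 0] and [t = pi]. *)
Definition spherical (t th : R) (i : 'I_3) : R :=
  if i == 0 then sin t * cos th else if i == 1 then sin t * sin th else cos t.

Lemma spherical_subproof t th :
  \sum_(i < 3) (\row_i spherical t th i) 0 i ^+ 2 == 1.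
Proof.
rewrite sum_ord3 !mxE /spherical /= !exprMn -mulrDr cos2Dsin2 mulr1.
by rewrite addrC cos2Dsin2.
Qed.

Definition sph (t th : R) : sphere R :=
  exist (fun p : 'rV[R]_3 => \sum_(i < 3) p 0 i ^+ 2 == 1) _
    (spherical_subproof t th).

Lemma val_sph t th i : val (sph t th) 0 i = spherical t th i.
Proof. by rewrite /= mxE. Qed.

(** Up to sign, bracketing with x_3 is the infinitesimal rotation about the third axis, which is
    d_th. *)
Lemma is_derive_longitude f (t th : R) :
  is_derive th 1 (fun th => val f (sph t th))
    (- val (pi_bracket f (Defs.coord R 2)) (sph t th)).
Proof.
pose w (i : 'I_3) : R := if i == 0 then - (sin t * sin th)
  else if i == 1 then sin t * cos th else 0.
have dw i : is_derive th 1 (fun r => val (sph t r) 0 i) (w i).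
  under eq_fun do rewrite val_sph.
  rewrite /spherical /w; case: (ord3P i) => -> /=; last exact: is_derive_cst.
    have := is_deriveZ (sin t) (is_derive_cos th).
    by rewrite -[sin t *: - sin th]/(sin t * - sin th) mulrN.
  by have := is_deriveZ (sin t) (is_derive_sin th).
apply: is_derive_eq (is_derive_curve f dw) _.
rewrite pi_bracket_coord opprK sum_ord3 /triple !val_sph /spherical /w /=.
move: (partial _ 0 _) (partial _ 1 _) (partial _ 2 _) => a0 a1 a2.
move: (sin t) (cos t) (sin th) (cos th); clear => *; ring.
Qed.

(** Motion along a meridian is rotation about the horizontal axis (- sin th, cos th, 0). Written
    with brackets, the derivative involves no division by [sin t] and is jointly continuous. *)
Lemma is_derive_colatitude f (t th : R) :
  is_derive t 1 (fun t => val f (sph t th))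
    (sin th * val (pi_bracket f (Defs.coord R 0)) (sph t th)
     - cos th * val (pi_bracket f (Defs.coord R 1)) (sph t th)).
Proof.
pose w (i : 'I_3) : R := if i == 0 then cos t * cos th
  else if i == 1 then cos t * sin th else - sin t.
have dw i : is_derive t 1 (fun r => val (sph r th) 0 i) (w i).
  under eq_fun do rewrite val_sph.
  rewrite /spherical /w; case: (ord3P i) => -> /=; last exact: is_derive_cos.
    under eq_fun do rewrite mulrC; rewrite mulrC.
    by have := is_deriveZ (cos th) (is_derive_sin t).
  under eq_fun do rewrite mulrC; rewrite mulrC.
  by have := is_deriveZ (sin th) (is_derive_sin t).
apply: is_derive_eq (is_derive_curve f dw) _.
rewrite !pi_bracket_coord sum_ord3 /triple !val_sph /spherical /w /=.
move: (partial _ 0 _) (partial _ 1 _) (partial _ 2 _) => a0 a1 a2.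
have := cos2Dsin2 th.
move: (sin t) (cos t) (sin th) (cos th); clear => st ct s c cs.
(* Inserting the factor cos^2 + sin^2 = 1 by hand makes the rest a polynomial identity. *)
have -> : - st * a2 = - st * (c ^+ 2 + s ^+ 2) * a2 by rewrite cs mulr1.
ring.
Qed.

Lemma continuous_sph f : continuous2 (fun t th => val f (sph t th)).
Proof.
move=> z.
have cc : continuous (fun z : R * R => val (sph z.1 z.2) : 'rV[R]_3).
  have -> : (fun z : R * R => val (sph z.1 z.2) : 'rV[R]_3) =
      (fun z => (sin z.1 * cos z.2) *: 'e_0 + (sin z.1 * sin z.2) *: 'e_1
        + cos z.1 *: 'e_2).
    apply/funext => y; apply/rowP => i; rewrite !mxE /spherical.
    by case: (ord3P i) => -> /=; rewrite ?(mulr0, mulr1, addr0, add0r).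
  move=> y.
  have c1 (g : R -> R) : continuous g -> (fun z : R * R => g z.1) @ y --> g y.1.
    by move=> cg; apply: continuous_cvg; [exact: cg|exact: cvg_fst].
  have c2 (g : R -> R) : continuous g -> (fun z : R * R => g z.2) @ y --> g y.2.
    by move=> cg; apply: continuous_cvg; [exact: cg|exact: cvg_snd].
  have cs1 := c1 _ (@continuous_sin R); have cc1 := c1 _ (@continuous_cos R).
  have cs2 := c2 _ (@continuous_sin R); have cc2 := c2 _ (@continuous_cos R).
  apply: cvgD; last by apply: cvgZr_tmp.
  by apply: cvgD; apply: cvgZr_tmp; apply: cvgM.
have [U [oU Us sF eF]] := extensionP f (sph z.1 z.2).
set F := extension f _ in sF eF.
have cF : {for val (sph z.1 z.2), continuous F}.
  by apply: differentiable_continuous; exact: smooth_differentiable sF Us.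
have nU : \forall y \near z, U (val (sph y.1 y.2)).
  by apply: cc; exact: open_nbhs_nbhs.
rewrite /continuous_at (eF _ Us).
apply: cvg_trans (cvg_comp _ _ (cc z) cF).
apply: near_eq_cvg; apply: filterS nU => y Uy.
by rewrite /= -(eF (sph y.1 y.2)).
Qed.

End SphericalCoordinates.

(** * The averaged equation *)

Section CosineEquation.
Variable R : realType.
Implicit Types (P Q : R -> R).

(** An existing derivative is also the one-sided limit of the difference quotients, and those vanish
    on this side. *)
Lemma derive_eq0_left P (t0 d a : R) : a < t0 -> is_derive t0 1 P d ->
  (forall t, a < t -> t <= t0 -> P t = 0) -> d = 0.
Proof.
move=> at0 [dP <-] P0; rewrite /derive cvg_at_leftE//.
apply: cvg_lim => //; apply: cvg_near_cst; near=> h => /=.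
have h0 : h <= 0 by apply: ltW; near: h; exact: nbhs_left_lt.
have ah : a - t0 < h by near: h; apply: nbhs_left_gt; rewrite subr_lt0.
rewrite -[h *: 1]/(h * 1) mulr1 !P0 ?subrr ?scaler0//.
- by rewrite -ltrBlDr.
- by rewrite gerDr.
Unshelve. all: by end_near. Qed.

Lemma derive_eq0_right P (t0 d b : R) : t0 < b -> is_derive t0 1 P d ->
  (forall t, t0 <= t -> t < b -> P t = 0) -> d = 0.
Proof.
move=> t0b [dP <-] P0; rewrite /derive cvg_at_rightE//.
apply: cvg_lim => //; apply: cvg_near_cst; near=> h => /=.
have h0 : 0 <= h by apply: ltW; near: h; exact: nbhs_right_gt.
have hb : h < b - t0 by near: h; apply: nbhs_right_lt; rewrite subr_gt0.
rewrite -[h *: 1]/(h * 1) mulr1 !P0 ?subrr ?scaler0//.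
- by rewrite lerDr.
- by rewrite -ltrBrDr.
Unshelve. all: by end_near. Qed.

Lemma is_derive_cst_sub_cos (c t : R) : is_derive t 1 (fun t => c - cos t) (sin t).
Proof.
have := is_deriveB (is_derive_cst c t (1 : R)) (is_derive_cos t).
by rewrite sub0r opprK.
Qed.

(** The equation says that [P t / (c - cos t)] has zero derivative where the denominator is nonzero;
    the conclusion is cross-multiplied. *)
Lemma cosine_ode_away P P' (c a b : R) :
  (forall t : R, is_derive t 1 P (P' t)) ->
  (forall t, (c - cos t) * P' t = sin t * P t) ->
  a < b -> (forall t, a <= t <= b -> c - cos t != 0) ->
  P b * (c - cos a) = P a * (c - cos b).
Proof.
move=> dP ode ab gn0.
pose Q := P * (fun t => (c - cos t)^-1).
have dQ (t : R) : a <= t <= b -> is_derive t 1 Q 0.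
  move=> /gn0 g0; have dg := is_derive_cst_sub_cos c t.
  have dV := @is_deriveV R (fun t => c - cos t) t (sin t) 1 g0 dg.
  have dM := is_deriveM (dP t) dV.
  apply: (is_derive_eq dM).
  rewrite -[P t *: _]/(P t * (- (c - cos t) ^- 2 * sin t)).
  rewrite -[_ *: P' t]/((c - cos t)^-1 * P' t).
  have := ode t; move: (P t) (P' t) (sin t) g0; set g := c - cos t.
  move: g; clear => g p p' s g0 gp'.
  have -> : p' = s * p / g by rewrite -gp' mulrC mulKf.
  by field.
have [||t tab] := @MVT R Q (fun=> 0) a b ab.
- by move=> t tab; apply: dQ; rewrite !ltW ?(itvP tab).
- apply: derivable_within_continuous => t; rewrite in_itv/= => tab.
  by have [] := dQ t tab.
rewrite mul0r => /eqP; rewrite subr_eq0 /Q !fctE.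
have ga := gn0 a; have gb := gn0 b; rewrite !lexx !(ltW ab) /= in ga gb.
by rewrite eqr_div ?ga ?gb// => /eqP.
Qed.

(* Off the zero of c - cos t the solutions are the multiples of c - cos t, and
   differentiability at that zero forces the two multiples to agree. *)
Lemma cosine_ode_rigidity P P' (c : R) : `|c| < 1 ->
  (forall t : R, is_derive t 1 P (P' t)) ->
  (forall t, (c - cos t) * P' t = sin t * P t) ->
  P 0 * (c + 1) = P pi * (c - 1).
Proof.
rewrite ltr_norml => /andP[c1 c2] dP ode.
pose t0 := acos c.
have cI : -1 <= c <= 1 by rewrite !ltW.
have ct0 : cos t0 = c by apply: acosK; rewrite in_itv.
have t0_gt0 : 0 < t0 by apply: acos_gt0; rewrite c2 ltW.
have t0_ltpi : t0 < pi by apply: acos_ltpi; rewrite c1 ltW.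
have st0 : sin t0 != 0 by rewrite gt_eqF// sin_gt0_pi// t0_gt0.
have gn0 t : 0 <= t <= pi -> t != t0 -> c - cos t != 0.
  move=> tI tt0; rewrite subr_eq0 -ct0; apply: contra_neq tt0 => E.
  by apply: cos_inj; rewrite ?in_itv//= !ltW.
have P0 : P t0 = 0.
  have /esym/eqP := ode t0; rewrite ct0 subrr mul0r mulf_eq0 (negbTE st0) /=.
  by move/eqP.
have dlin (k m : R) : is_derive t0 1 (fun t => k * P t - m * (c - cos t))
    (k * P' t0 - m * sin t0).
  exact: is_deriveB (is_deriveZ k (dP t0)) (is_deriveZ m (is_derive_cst_sub_cos c t0)).
(* Left of [t0], comparison with [t = 0], where c - cos t is [c - 1], shows that
   [(c - 1) * P t - P 0 * (c - cos t)] vanishes. On the right the reference point is [pi], with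
   value [c + 1]. *)
have left : (c - 1) * P' t0 - P 0 * sin t0 = 0.
  apply: derive_eq0_left t0_gt0 (dlin _ _) _ => t tpos.
  rewrite le_eqVlt => /predU1P[->|tt0]; first by rewrite P0 ct0 subrr !mulr0 subrr.
  have := @cosine_ode_away P P' c 0 t dP ode tpos.
  rewrite cos0 => <-; first by rewrite mulrC subrr.
  move=> s /andP[s0 st]; apply: gn0.
    by rewrite s0 (le_trans st)// (le_trans (ltW tt0))// ltW.
  by rewrite lt_eqF// (le_lt_trans st).
have right : (c + 1) * P' t0 - P pi * sin t0 = 0.
  apply: derive_eq0_right t0_ltpi (dlin _ _) _ => t + tpi.
  rewrite le_eqVlt => /predU1P[<-|tt0]; first by rewrite P0 ct0 subrr !mulr0 subrr.
  have := @cosine_ode_away P P' c t pi dP ode tpi.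
  rewrite cospi opprK => ->; first by rewrite mulrC subrr.
  move=> s /andP[ts spi]; apply: gn0.
    by rewrite spi (le_trans _ ts)// (le_trans (ltW t0_gt0))// ltW.
  by rewrite gt_eqF// (lt_le_trans tt0).
(* Both sides times [sin t0] equal [(c - 1) * (c + 1) * P' t0]. *)
apply: (mulIf st0).
move/subr0_eq in left; move/subr0_eq in right.
by rewrite (mulrAC (P 0)) (mulrAC (P pi)) -left -right mulrAC (mulrC (c - 1)) mulrAC.
Qed.

End CosineEquation.

(** * Nontriviality of the deformation *)

Section NecklaceNontrivial.
Variable R : realType.
Implicit Types (f g : Cinf R) (D : Cinf R -> Cinf R) (p : sphere R).

Lemma pi_bracket_coord_coord (i j : 'I_3) p :
  val (pi_bracket (Defs.coord R i) (Defs.coord R j)) p =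
  - triple (fun k => val p 0 k) (fun k => (k == i)%:R) (fun k => (k == j)%:R).
Proof.
apply: etrans (pi_bracket_val (extends_near_coord i p) (extends_near_coord j p)) _.
apply: (congr1 -%R); rewrite rot_bivector_triple.
by apply: eq_triple => k; exact: partial_coord.
Qed.

Lemma pi_bracket_coord12 :
  pi_bracket (Defs.coord R 1) (Defs.coord R 2) = - Defs.coord R 0.
Proof.
apply/val_inj/funext => p; apply: etrans (pi_bracket_coord_coord 1 2 p) _.
by rewrite /triple /= !(mulr0, mulr1, subr0, addr0).
Qed.

Lemma pi_bracket_coord20 :
  pi_bracket (Defs.coord R 2) (Defs.coord R 0) = - Defs.coord R 1.
Proof.
apply/val_inj/funext => p; apply: etrans (pi_bracket_coord_coord 2 0 p) _.
by rewrite /triple /= !(mulr0, mulr1, subr0, addr0, add0r, oppr0).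
Qed.

Lemma sum_coord2 : \sum_(i < 3) Defs.coord R i ^+ 2 = 1 :> Cinf R.
Proof.
apply/val_inj/funext => p; have /eqP := valP p; rewrite sum_ord3 sum_I3 => E.
have coords2 i : val (Defs.coord R i ^+ 2) p = val p 0 i ^+ 2 by rewrite !expr2.
by apply: etrans E; rewrite -!coords2.
Qed.

(** The horizontal coordinates are [si * co] and [si * s]; projecting the two equations on the
    direction [(co, s)] leaves the radius [si]. *)
Lemma polar_combination (g u2 a x y si s co : R) : co ^+ 2 + s ^+ 2 = 1 ->
  g * x - u2 * (si * co) = - (a * (si * co)) ->
  g * y - u2 * (si * s) = - (a * (si * s)) ->
  g * (co * x + s * y) = si * (u2 - a).
Proof.
move=> cs; move/(canRL (subrK _)) => ex; move/(canRL (subrK _)) => ey.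
rewrite mulrDr (mulrCA g co) (mulrCA g s) ex ey -[RHS]mulr1 -cs.
by ring.
Qed.

(* With u i = X(x_(i+1)), the first two equations are [pi_c, X] = a pi on the
   pairs (x_2, x_3) and (x_3, x_1), and the third one says that X is tangent to
   the sphere. Weighted by cos th and sin th, the first two add up to
     (c - cos t) (d_t U - d_th V) = sin t (U - a)
   for U = u 2 and V = cos th * u 1 - sin th * u 0, which is then averaged over
   th. *)
Lemma necklace_ode (u : 'I_3 -> Cinf R) (c a : R) (x : Cinf R) :
  x = c%:A - Defs.coord R 2 ->
  x * (pi_bracket (u 1) (Defs.coord R 2) - pi_bracket (u 2) (Defs.coord R 1) + u 0)
    - u 2 * Defs.coord R 0 = - (a *: Defs.coord R 0) ->
  x * (pi_bracket (u 2) (Defs.coord R 0) - pi_bracket (u 0) (Defs.coord R 2) + u 1)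
    - u 2 * Defs.coord R 1 = - (a *: Defs.coord R 1) ->
  \sum_i Defs.coord R i * u i = 0 ->
  `|c| < 1 -> a = 0.
Proof.
move=> -> E0 E1 E2 hc.
pose U t th := val (u 2) (sph t th).
pose B i j t th := val (pi_bracket (u i) (Defs.coord R j)) (sph t th).
pose U' t th := sin th * B 2 0 t th - cos th * B 2 1 t th.
pose V t th := cos th * val (u 1) (sph t th) - sin th * val (u 0) (sph t th).
pose V' t th := (cos th * - B 1 2 t th + - sin th * val (u 1) (sph t th))
  - (sin th * - B 0 2 t th + cos th * val (u 0) (sph t th)).
have csnd (g : R -> R) : continuous g -> continuous2 (fun _ th => g th).
  move=> cg z; rewrite /continuous_at.
  by apply: (@continuous_cvg _ _ _ _ _ snd g); [exact: cg|exact: cvg_snd].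
have csin2 := csnd _ (@continuous_sin R).
have ccos2 := csnd _ (@continuous_cos R).
have cB i j : continuous2 (B i j) by exact: continuous_sph.
have cu i : continuous2 (fun t th => val (u i) (sph t th)) by exact: continuous_sph.
have cU' : continuous2 U'.
  by move=> z; apply: cvgB; apply: cvgM; [exact: csin2|exact: cB|exact: ccos2|exact: cB].
have cV' : continuous2 V'.
  move=> z; apply: cvgB; apply: cvgD; apply: cvgM.
  - exact: ccos2.
  - by apply: cvgN; exact: cB.
  - by apply: cvgN; exact: csin2.
  - exact: cu.
  - exact: csin2.
  - by apply: cvgN; exact: cB.
  - exact: ccos2.
  - exact: cu.
have dU (t th : R) : is_derive t 1 (U ^~ th) (U' t th) by exact: is_derive_colatitude.
have dV (t th : R) : is_derive th 1 (V t) (V' t th).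
  have H := is_deriveB (is_deriveM (is_derive_cos th) (is_derive_longitude (u 1) t th))
    (is_deriveM (is_derive_sin th) (is_derive_longitude (u 0) t th)).
  apply: (is_derive_eq H).
  exact: (congr2 (fun y z => (cos th * - B 1 2 t th + y) - (sin th * - B 0 2 t th + z))
    (mulrC _ _) (mulrC _ _)).
have perV t : V t (pi *+ 2) = V t 0.
  have E : sph t (pi *+ 2) = sph t 0.
    apply/val_inj/rowP => i; rewrite !val_sph /spherical.
    by rewrite cos2pi sin2pi cos0 sin0.
  by rewrite /V E cos2pi sin2pi cos0 sin0.
have E t th : (c - cos t) * (U' t th - V' t th) = sin t * (U t th - a).
  have e0 : (c * 1 - val (sph t th) 0 2)
      * (B 1 2 t th - B 2 1 t th + val (u 0) (sph t th))
      - U t th * val (sph t th) 0 0 = - (a * val (sph t th) 0 0) :=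
    congr1 (fun f : Cinf R => val f (sph t th)) E0.
  have e1 : (c * 1 - val (sph t th) 0 2)
      * (B 2 0 t th - B 0 2 t th + val (u 1) (sph t th))
      - U t th * val (sph t th) 0 1 = - (a * val (sph t th) 0 1) :=
    congr1 (fun f : Cinf R => val f (sph t th)) E1.
  rewrite !val_sph mulr1 in e0 e1.
  apply: etrans (polar_combination (cos2Dsin2 th) e0 e1); congr (_ * _).
  rewrite /U' /V'; move: (B 2 0 t th) (B 2 1 t th) (B 1 2 t th) (B 0 2 t th).
  move: (val (u 0) _) (val (u 1) _) (sin th) (cos th); clear => *; ring.
pose mean (W : R -> R -> R) (t : R) := \int[@lebesgue_measure R]_(th in `[0%R, (pi *+ 2)%R]) (W t th : R).
have ode := mean_ode (cu 2) cU' cV' dU dV perV E.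
have dP (t : R) : is_derive t 1 (fun t => mean U t - a * (pi *+ 2)) (mean U' t).
  have := is_deriveB (is_derive_mean t (cu 2) cU' dU) (is_derive_cst (a * (pi *+ 2)) t (1 : R)).
  by rewrite subr0.
(* At a pole only x_3 is nonzero, so tangency forces the third component of X to vanish there. *)
have U0 t th : sin t = 0 -> U t th = 0.
  move=> st; rewrite sum_I3 in E2.
  have : val (sph t th) 0 0 * val (u 0) (sph t th)
      + val (sph t th) 0 1 * val (u 1) (sph t th)
      + val (sph t th) 0 2 * U t th = 0 :=
    congr1 (fun f : Cinf R => val f (sph t th)) E2.
  rewrite !val_sph /spherical /= st !mul0r !add0r => /eqP.
  rewrite mulf_eq0 => /orP[/eqP ct|/eqP//].
  by have := cos2Dsin2 t; rewrite ct st expr0n addr0 => /eqP; rewrite eq_sym oner_eq0.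
have mean0 t : sin t = 0 -> mean U t = 0.
  move=> st; rewrite /mean (@eq_Rintegral _ _ _ _ _ (cst 0)) => [|th _]; last exact: U0.
  by rewrite Rintegral_cst ?mul0r.
have := cosine_ode_rigidity hc dP ode.
rewrite !mean0 ?sin0 ?sinpi// sub0r.
have pi2 : pi *+ 2 != 0 :> R by rewrite gt_eqF// mulrn_wgt0// pi_gt0.
(* Applied to [y = a * (pi *+ 2)]: the function in [dP] equals [- y] at both poles. *)
have two y : - y * (c + 1) = - y * (c - 1) -> y = 0.
  move=> xc; have : y *+ 2 = - y * (c - 1) - - y * (c + 1) by move: y {xc}; clear => y; ring.
  by rewrite xc subrr => /eqP; rewrite mulrn_eq0 => /eqP.
by move/two/eqP; rewrite mulf_eq0 (negbTE pi2) orbF => /eqP.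
Qed.


(** Matches the value of [pi_c, X] on two coordinates whose bracket is [- y] with the form used in
    [necklace_ode]; [d] is X(y) and [d'] is X(x_3). *)
Lemma necklace_regroup (A : comNzRingType) (x p q d d' y : A) :
  x * (p - q + d) - d' * y = x * p - x * q - (x * - d - - y * d').
Proof. by ring. Qed.

(** A primitive is a derivation [D]; its values [u] on the coordinates satisfy the hypotheses of
    [necklace_ode], which gives [a = 0]. *)
Lemma sphere_pi_not_coboundary (c a : R) : `|c| < 1 -> a != 0 ->
  ~ coboundaries (necklace c) 2 (a *: @sphere_pi R).
Proof.
move=> hc a0 [P [linP altP derP] EP].
pose D (f : Cinf R) := P (fun=> f).
have PD : P = fun f : 'I_1 -> Cinf R => D (f 0).
  by apply/funext => h; congr P; apply/funext => i; rewrite ord1.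
have upd (f g : Cinf R) : update (fun _ : 'I_1 => f) 0 g = fun=> g.
  by apply/funext => i; rewrite /update ord1.
have Dlin r f g : D (r *: f + g) = r *: D f + D g.
  by have := linP (fun=> 0) 0 r f g; rewrite !upd.
have DM f g : D (f * g) = f * D g + g * D f.
  by have := derP (fun=> 0) 0 f g; rewrite !upd.
have D0 : D 0 = 0.
  by have := Dlin (-1) 0 0; rewrite scaler0 addr0 scaleN1r addNr.
have DN f : D (- f) = - D f.
  by rewrite -scaleN1r -[_ *: f]addr0 Dlin D0 addr0 scaleN1r.
have D1 : D 1 = 0.
  have := DM 1 1; rewrite !mul1r => /eqP; rewrite -subr_eq0 opprD addrA subrr sub0r.
  by rewrite oppr_eq0 => /eqP.
pose x : Cinf R := c%:A - Defs.coord R 2.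
pose u i := D (Defs.coord R i).
have Dx : D x = - u 2 by rewrite /x Dlin D1 scaler0 add0r DN.
have E (f g : Cinf R) : x * pi_bracket (D f) g - x * pi_bracket (D g) f
    - (x * D (pi_bracket f g) - pi_bracket f g * u 2) = a *: pi_bracket f g.
  pose fg (i : 'I_2) := if i == 0 then f else g.
  have <- : dpi (necklace c) P fg = a *: pi_bracket f g by rewrite EP.
  rewrite PD; apply: esym.
  apply: etrans (dpi1 (fun f g => x * pi_bracket f g) D fg) _.
  rewrite /fg /=.
  by rewrite DM Dx mulrN.
move/eqP: a0; apply; apply: (@necklace_ode u c a x) => //.
- have := E (Defs.coord R 1) (Defs.coord R 2).
  rewrite pi_bracket_coord12 DN scalerN => <-.
  exact: necklace_regroup.
- have := E (Defs.coord R 2) (Defs.coord R 0).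
  rewrite pi_bracket_coord20 DN scalerN => <-.
  exact: necklace_regroup.
(* Tangency to the sphere: [D] kills the constant x_1^2 + x_2^2 + x_3^2 = 1. *)
- have : D (\sum_i Defs.coord R i ^+ 2) = (\sum_i Defs.coord R i * u i) *+ 2.
    have DD f g : D (f + g) = D f + D g by rewrite -[f]scale1r Dlin !scale1r.
    have DX f : D (f ^+ 2) = f * D f *+ 2 by rewrite expr2 DM mulr2n.
    by rewrite !sum_I3 !DD !DX !mulrnDl.
  rewrite sum_coord2 D1 => /esym/eqP; rewrite -scaler_nat scaler_eq0 pnatr_eq0.
  by move=> /eqP.
Qed.

Lemma sphere_pi_nontrivial (c a : R) : `|c| < 1 -> a != 0 ->
  nontrivial_deformation (necklace c) (a *: @sphere_pi R).
Proof.
move=> hc a0; split; first exact: sphere_pi_cocycle.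
set sigma := a *: @sphere_pi R => eq_class.
(* If the cosets were equal, [sigma], which lies in its own coset because 0 is the coboundary of the
   zero field, would lie in that of 0. *)
have E : coboundaries (necklace c) 2 (sigma - sigma) =
    coboundaries (necklace c) 2 (sigma - 0) :=
  congr1 (fun S : set (multimap (Cinf R) 2) => S sigma) eq_class.
apply: (sphere_pi_not_coboundary hc a0).
move: E; rewrite subrr subr0 => <-; exists (fun=> 0).
  by split=> // [h i *|h i *]; rewrite ?scaler0 ?mulr0 addr0.
apply/funext => h; apply: etrans (dpi1 (fun f g => (c%:A - Defs.coord R 2) *
  pi_bracket f g) (fun=> 0) h) _.
by rewrite !pi_bracket0 !mulr0 !subr0.
Qed.

Lemma necklaceB (c c' : R) : necklace c' - necklace c = (c' - c) *: @sphere_pi R.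
Proof.
apply/funext => h; rewrite /necklace /mulmv !fctE -mulrBl.
by rewrite opprB addrA subrK -scalerBl -scalerAl mul1r.
Qed.

End NecklaceNontrivial.

Theorem corollary3p4 (R : realType) (c c' : R)
    (hc : `|c| < 1) (hc' : `|c'| < 1) (hcc' : c <> c') :
  [/\ necklace c' - necklace c = (c' - c) *: @sphere_pi R,
      nontrivial_deformation (necklace c) (necklace c' - necklace c) &
      nontrivial_deformation (necklace c') (necklace c - necklace c')].
Proof.
move/eqP in hcc'; split; rewrite ?necklaceB//.
  by apply: sphere_pi_nontrivial; rewrite // subr_eq0 eq_sym.
by apply: sphere_pi_nontrivial; rewrite // subr_eq0.
Qed.
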